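(* Let $p,n\geq 1$ be integers and let \[\lambda_1=\frac{2n+4(2p-1)}{4+n-2p+\sqrt{16n+n^2+32p-12np-28p^2}},\qquad \lambda_2=\frac{2n+4(2p-1)}{-n+2p+\sqrt{16-8n+n^2-48p+4np+36p^2}},\] where $p,n$ are such that the square root in $\lambda_1$ is real, and $\lambda_2$ is read as $+\infty$ if its denominator is $0$. Let $\lambda$ be a real number with $\lambda_1<\lambda<\lambda_2$. If $f\in\mathcal{A}_{p,n}$ satisfies, for all $z\in\mathbb{D}$, \[\operatorname{Re}\left(1+\frac{zf''(z)}{f'(z)}\right)<\begin{cases}\dfrac{2(1-p)\lambda^2+(4+n)\lambda+(2-2p-n)}{2(\lambda+1)}, & \text{if } \lambda_1<\lambda\leq\dfrac{p+n}{p},\\[10pt] \dfrac{2(1-p)\lambda^2+n\lambda+(-2+2p+n)}{2(\lambda-1)}, & \text{if } \dfrac{p+n}{p}<\lambda<\lambda_2,\end{cases}\] then \[\frac{1}{p}\frac{zf'(z)}{f(z)}\prec\frac{\lambda(1-z)}{\lambda-z}.\]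
   Context: $\mathbb{D}=\{z\in\mathbb{C}:|z|<1\}$ is the open unit disk. For positive integers $p,n$, $\mathcal{A}_{p,n}$ is the class of all analytic functions $f:\mathbb{D}\to\mathbb{C}$ whose power series at $0$ has the form $f(z)=z^{p}+a_{n+p}z^{n+p}+a_{n+p+1}z^{n+p+1}+\cdots$. For analytic functions $F,G$ on $\mathbb{D}$, $F$ is subordinate to $G$, written $F\prec G$ (or $F(z)\prec G(z)$), if there is an analytic function $w:\mathbb{D}\to\mathbb{D}$ with $w(0)=0$ such that $F=G\circ w$. Quotients are understood as meromorphic functions on $\mathbb{D}$ with removable singularities removed; so at $z=0$ the function $1+zf''(z)/f'(z)$ has value $p$ and $\frac1p\, zf'(z)/f(z)$ has value $1$. An inequality assumed on $\mathbb{D}$ includes that the expression has no poles in $\mathbb{D}$; the subordination in the conclusion includes that $zf'(z)/f(z)$ is analytic on $\mathbb{D}$. *)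

(* Defs.v *)
From Stdlib Require Import Reals.
From Coquelicot Require Import Coquelicot.
Open Scope R_scope.

Definition disk (z : C) : Prop := Cmod z < 1.

Definition analytic_on_disk (f : C -> C) : Prop :=
  forall z : C, disk z -> @ex_derive C_AbsRing C_NormedModule f z.

Definition classA (p n : nat) (f : C -> C) : Prop :=
  analytic_on_disk f /\
  exists a : nat -> C,
    (forall k : nat, (k < p)%nat -> a k = RtoC 0) /\
    a p = RtoC 1 /\
    (forall k : nat, (p < k < n + p)%nat -> a k = RtoC 0) /\
    (forall z : C, disk z -> @is_pseries C_AbsRing C_NormedModule a z (f z)).

Definition subordinate (F G : C -> C) : Prop :=
  analytic_on_disk F /\ analytic_on_disk G /\
  exists w : C -> C,
    analytic_on_disk w /\
    (forall z : C, disk z -> disk (w z)) /\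
    w (RtoC 0) = RtoC 0 /\
    (forall z : C, disk z -> F z = G (w z)).

(* The meromorphic quotient N/D has only removable singularities in the disk
   and h is its analytic extension.  When D is analytic and not identically
   zero on the disk, its zeros are isolated, so h is determined on the disk. *)
Definition analytic_quotient (N D h : C -> C) : Prop :=
  analytic_on_disk h /\
  forall z : C, disk z -> D z <> RtoC 0 -> h z = (N z / D z)%C.

Definition disc1 (p n : R) : R :=
  16 * n + n ^ 2 + 32 * p - 12 * n * p - 28 * p ^ 2.

Definition lambda1 (p n : R) : R :=
  (2 * n + 4 * (2 * p - 1)) / (4 + n - 2 * p + sqrt (disc1 p n)).

(* The radicand is at least (n - 2 * p) ^ 2 when p, n >= 1, so that sqrt is
   never applied to a negative number here. *)
Definition lambda2_den (p n : R) : R :=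
  - n + 2 * p +
  sqrt (16 - 8 * n + n ^ 2 - 48 * p + 4 * n * p + 36 * p ^ 2).

Definition lambda2 (p n : R) : Rbar :=
  if Req_EM_T (lambda2_den p n) 0 then p_infty
  else Finite ((2 * n + 4 * (2 * p - 1)) / lambda2_den p n).

Definition re_bound (p n lam : R) : R :=
  if Rle_dec lam ((p + n) / p) then
    (2 * (1 - p) * lam ^ 2 + (4 + n) * lam + (2 - 2 * p - n)) / (2 * (lam + 1))
  else
    (2 * (1 - p) * lam ^ 2 + n * lam + (- 2 + 2 * p + n)) / (2 * (lam - 1)).

(* Main.v *)
(** Write [f = z^p phi], [B = z phi'] and [D = (lam - 1) p phi - B].  The Schwarz
    function of the subordination is [w = - lam B / D], and it has a zero of order
    at least [n] at 0.  If [|w| < 1] failed on the disk, take a point [z0] of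
    least modulus with [|B lam| >= |D|].  Jack's lemma gives [z0 w'(z0) = k w(z0)]
    with [k >= n] real, hence [1 + z0 f''/f'] equals
    [p lam (1 - w) / (lam - w) + k w (1 / (lam - w) - 1 / (1 - w))] with [|w| = 1],
    whose real part is at least [re_bound].  The zeros of [B] and [D] cannot meet
    because [f'] has no zero off the origin: [f''/f' = h/z] is bounded along rays.

    No Cauchy theory is used.  Everything is built from convergent power series,
    and the maximum principle comes from the second-derivative test applied to
    [|g|^2 + eps |z|^2]. *)

Require Import Defs.
From Stdlib Require Import Reals Lra Lia Classical ClassicalEpsilon FunctionalExtensionality.
From Coquelicot Require Import Coquelicot.
Open Scope R_scope.

(** * Complex derivatives *)

(** The formula for [w] is forced. With [q = 1 + B / (p phi)], the left side of the subordination,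
    solving [q = lam (1 - w) / (lam - w)] gives [w = lam (1 - q) / (lam - q)], and clearing [p phi]
    turns this into [- lam B / D]. The clearing matters: a priori [phi] may vanish, so that [z f'/f]
    may have poles. The estimate is therefore proved as [|lam B| < |D|], an inequality without
    quotients, and it excludes those poles afterwards, since a zero of [phi] would give [|D| = |B|].
    The boundary expression is a logarithmic derivative: [1 + z f''/f' = p q + z q'/q] and [z q'/q =
    z w' (1 / (lam - w) - 1 / (1 - w))]. On [|w| = 1] its real part depends on [w] only through
    [|lam - w|^2]. The lower limit on [lam] supplies [lam > 1], so the pole of the target map lies
    outside the closed disk. *)

Notation cd f z l := (@is_derive C_AbsRing C_NormedModule f (z%C : C) (l%C : C)).

Lemma is_linear_Cmult_r (l : C) :
  @is_linear C_AbsRing (AbsRing_NormedModule C_AbsRing) C_NormedModule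
    (fun s : C => (s * l)%C).
Proof.
split.
- intros x y. change ((x + y) * l = x * l + y * l)%C. ring.
- intros k x. change ((k * x) * l = k * (x * l))%C. ring.
- exists (Cmod l + 1). split.
  + generalize (Cmod_ge_0 l). lra.
  + intros x.
    change (Cmod (x * l)%C <= (Cmod l + 1) * Cmod x).
    rewrite Cmod_mult. generalize (Cmod_ge_0 x). nra.
Qed.

Lemma cd_def (f : C -> C) (z l : C) :
  cd f z l <->
  forall eps : R, 0 < eps -> exists delta : R, 0 < delta /\
    forall s : C, Cmod s < delta ->
      Cmod (f (z + s) - f z - s * l)%C <= eps * Cmod s.
Proof.
split.
- intros [_ H] eps Heps.
  destruct (H z (fun P HP => HP) (mkposreal eps Heps)) as [d Hd].
  exists d. split; [apply cond_pos|].
  intros s Hs.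
  specialize (Hd (z + s)%C).
  assert (E : (z + s - z)%C = s) by ring.
  assert (B : @ball (AbsRing_UniformSpace C_AbsRing) z d (z + s)%C).
  { change (Cmod (z + s - z)%C < d). now rewrite E. }
  specialize (Hd B).
  change (Cmod (f (z + s)%C - f z - (z + s - z) * l)%C <= eps * Cmod (z + s - z)%C) in Hd.
  now rewrite E in Hd.
- intros H. split.
  + exact (is_linear_Cmult_r l).
  + intros x Hx. apply (is_filter_lim_locally_unique (V := AbsRing_NormedModule C_AbsRing)) in Hx. subst x.
    intros eps. destruct (H eps (cond_pos eps)) as [d [Hd0 Hd]].
    exists (mkposreal d Hd0).
    assert (H' : forall y : C, Cmod (y - z)%C < d ->
      Cmod (f y - f z - (y - z) * l)%C <= eps * Cmod (y - z)%C).
    { intros y Hy. specialize (Hd _ Hy).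
      replace (z + (y - z))%C with y in Hd by ring. exact Hd. }
    exact H'.
Qed.

(* [C] carries two distinct normed module structures in Coquelicot; the product
   and chain rules are available for the [AbsRing] one only. *)
Lemma cd_absring (f : C -> C) (z l : C) :
  cd f z l <-> @is_derive C_AbsRing (AbsRing_NormedModule C_AbsRing) f z l.
Proof.
split.
- intros [_ H]. split.
  + apply is_linear_scal_l.
  + exact H.
- intros [_ H]. split.
  + exact (is_linear_Cmult_r l).
  + exact H.
Qed.

Lemma cd_eq (f : C -> C) (z l l' : C) : cd f z l -> l = l' -> cd f z l'.
Proof. now intros H <-. Qed.

Lemma cd_ext_loc (f g : C -> C) (z l : C) (r : R) :
  0 < r -> (forall y, Cmod (y - z)%C < r -> f y = g y) -> cd f z l -> cd g z l.
Proof.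
intros Hr E. apply is_derive_ext_loc.
exists (mkposreal r Hr). intros y Hy. apply E. exact Hy.
Qed.

Lemma cd_const (c z : C) : cd (fun _ => c) z 0.
Proof. apply (is_derive_const (V := C_NormedModule) c z). Qed.

Lemma cd_id (z : C) : cd (fun y => y) z 1.
Proof. apply cd_absring, (is_derive_id z). Qed.

Lemma cd_plus (f g : C -> C) (z l m : C) :
  cd f z l -> cd g z m -> cd (fun y => f y + g y)%C z (l + m)%C.
Proof. exact (is_derive_plus f g z l m). Qed.

Lemma cd_minus (f g : C -> C) (z l m : C) :
  cd f z l -> cd g z m -> cd (fun y => f y - g y)%C z (l - m)%C.
Proof. exact (is_derive_minus f g z l m). Qed.

Lemma cd_mult (f g : C -> C) (z l m : C) :
  cd f z l -> cd g z m -> cd (fun y => f y * g y)%C z (l * g z + f z * m)%C.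
Proof.
intros Hf Hg. apply cd_absring in Hf. apply cd_absring in Hg.
apply cd_absring.
exact (is_derive_mult f g z l m Hf Hg Cmult_comm).
Qed.

Lemma cd_Cinv (z : C) : z <> 0%C -> cd Cinv z (- / (z * z))%C.
Proof.
intros Hz. apply cd_def. intros eps Heps.
assert (Hm : 0 < Cmod z) by now apply Cmod_gt_0.
set (M := Cmod z) in *.
(* The remainder is [s^2 / (z^2 (z + s))]. The first bound keeps [|z + s| >= M / 2]; the second then
   makes the remainder at most [eps |s|]. *)
exists (Rmin (M / 2) (eps * (M * M * M) / 2)). split.
{ apply Rmin_pos; [lra|].
  assert (0 < eps * (M * M * M)) by (repeat apply Rmult_lt_0_compat; lra). lra. }
intros s Hs.
assert (H1 : Cmod s < M / 2) by (eapply Rlt_le_trans; [exact Hs | apply Rmin_l]).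
assert (H2 : Cmod s < eps * (M * M * M) / 2)
  by (eapply Rlt_le_trans; [exact Hs | apply Rmin_r]).
assert (H3 : M / 2 <= Cmod (z + s)%C).
{ generalize (Cmod_triangle (z + s) (- s)). rewrite Cmod_opp.
  replace (z + s + - s)%C with z by ring. unfold M in *. lra. }
assert (Hzs : (z + s)%C <> 0%C).
{ apply Cmod_gt_0. lra. }
replace (/ (z + s) - / z - s * - / (z * z))%C
  with (s * s * (/ (z * z) * / (z + s)))%C by (field; auto).
assert (Hzz : (z * z)%C <> 0%C) by now apply Cmult_neq_0.
rewrite !Cmod_mult, !Cmod_inv, Cmod_mult by assumption. fold M.
assert (H0 := Cmod_ge_0 s).
rewrite Rmult_assoc, (Rmult_comm eps). apply Rmult_le_compat_l; [assumption|].
assert (0 < M * M) by nra.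
apply Rmult_le_reg_r with (M * M * Cmod (z + s)).
{ apply Rmult_lt_0_compat; lra. }
replace (Cmod s * (/ (M * M) * / Cmod (z + s)) * (M * M * Cmod (z + s)))
  with (Cmod s) by (field; lra).
apply Rle_trans with (eps * (M * M * (M / 2))); [lra|].
apply Rmult_le_compat_l; [lra|]. apply Rmult_le_compat_l; lra.
Qed.

Lemma cd_inv (f : C -> C) (z l : C) :
  f z <> 0%C -> cd f z l -> cd (fun y => / f y)%C z (- l / (f z * f z))%C.
Proof.
intros Hz Hf. apply cd_absring in Hf.
eapply cd_eq.
- exact (is_derive_comp (V := C_NormedModule) Cinv f z _ l (cd_Cinv _ Hz) Hf).
- change (l * - / (f z * f z) = - l / (f z * f z))%C. field. exact Hz.
Qed.

Lemma cd_div (f g : C -> C) (z l m : C) :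
  g z <> 0%C -> cd f z l -> cd g z m ->
  cd (fun y => f y / g y)%C z ((l * g z - f z * m) / (g z * g z))%C.
Proof.
intros Hz Hf Hg. eapply cd_eq.
- exact (cd_mult f (fun y => / g y)%C z _ _ Hf (cd_inv g z m Hz Hg)).
- simpl. field. exact Hz.
Qed.

Lemma cd_pow (n : nat) (z : C) :
  cd (fun y => y ^ S n)%C z (INR (S n) * z ^ n)%C.
Proof.
induction n as [|n IH].
- apply cd_ext_loc with (fun y : C => y) 1; [lra| |].
  + intros y _. simpl. ring.
  + eapply cd_eq; [apply cd_id|]. simpl. ring.
- eapply cd_eq.
  + exact (cd_mult (fun y => y) (fun y => y ^ S n)%C z _ _ (cd_id z) IH).
  + rewrite (S_INR (S n)), RtoC_plus. simpl. ring.
Qed.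

Lemma cd_continuous (f : C -> C) (z l : C) :
  cd f z l -> continuous (T := C_UniformSpace) (U := C_UniformSpace) f z.
Proof.
intros H P HP.
assert (Hc : ex_derive (K := C_AbsRing) (V := C_NormedModule) f z) by now exists l.
apply ex_derive_continuous in Hc.
apply locally_C. exact (Hc P HP).
Qed.

Lemma continuous_Cmod (f : C -> C) (z : C) :
  continuous (T := C_UniformSpace) (U := C_UniformSpace) f z ->
  continuous (T := C_UniformSpace) (fun y => Cmod (f y)) z.
Proof.
intros H.
apply (continuous_comp (U := C_UniformSpace) (V := C_UniformSpace) f Cmod); [exact H|].
exact (filterlim_norm (V := C_NormedModule) (f z)).
Qed.

(** * Complex power series *)

Notation cseries u l := (@is_series C_AbsRing C_NormedModule u (l%C : C)).

(** Stated on the moduli, so that the theory of real power series (shift, derivative, convergence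
    inside the radius) serves complex coefficients. *)
Definition radius_ge_1 (b : nat -> C) : Prop :=
  Rbar_le 1 (CV_radius (fun k => Cmod (b k))).

(* Unspecified where the series diverges. *)
Definition psum (b : nat -> C) (z : C) : C :=
  epsilon (inhabits (RtoC 0)) (fun l => cseries (fun k => b k * z ^ k)%C l).

Definition cshift (b : nat -> C) (k : nat) : C := b (S k).

Definition cderive (b : nat -> C) (k : nat) : C := (INR (S k) * b (S k))%C.

Lemma cseries_unique (u : nat -> C) (l m : C) :
  cseries u l -> cseries u m -> l = m.
Proof. exact (filterlim_locally_unique (V := C_NormedModule) (sum_n u) l m). Qed.

Lemma cseries_lim_0 (u : nat -> C) (l : C) :
  cseries u l -> is_lim_seq (fun k => Cmod (u k)) 0.
Proof.
intros H.
assert (Hcomp : forall p : C -> R, (p = fst \/ p = snd) ->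
  is_lim_seq (fun k => Rabs (p (u k))) 0).
{ intros p Hp. apply (is_lim_seq_abs_0 (fun k => p (u k))), ex_series_lim_0.
  exists (p l).
  assert (Hc : filterlim p (locally (l : C_UniformSpace)) (locally (p l))).
  { destruct l. destruct Hp as [-> | ->];
      [exact (continuous_fst _ _) | exact (continuous_snd _ _)]. }
  apply filterlim_ext with (fun n => p (sum_n (G := C_NormedModule) u n)).
  - intros n. induction n as [|n IH]; [now rewrite !sum_O|].
    rewrite !sum_Sn, <- IH. now destruct Hp as [-> | ->].
  - exact (filterlim_comp _ _ _ _ p eventually _ _ H Hc). }
apply is_lim_seq_le_le with (fun _ => 0)
  (fun k => sqrt 2 * (Rabs (fst (u k)) + Rabs (snd (u k)))).
- intros k. split; [apply Cmod_ge_0|].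
  eapply Rle_trans; [apply Cmod_2Rmax|].
  apply Rmult_le_compat_l; [apply sqrt_pos|].
  generalize (Rabs_pos (fst (u k))) (Rabs_pos (snd (u k))).
  apply Rmax_case; lra.
- apply is_lim_seq_const.
- replace (Finite 0) with (Rbar_mult (sqrt 2) (0 + 0))
    by (simpl; f_equal; ring).
  apply is_lim_seq_scal_l, is_lim_seq_plus'; apply Hcomp; auto.
Qed.

Lemma cseries_norm_le (u : nat -> C) (B : nat -> R) (l : C) :
  (forall k, Cmod (u k) <= B k) -> ex_series B -> cseries u l ->
  Cmod l <= Series B.
Proof.
intros HB HsB Hu.
apply (is_lim_seq_le (fun n => Cmod (sum_n (G := C_NormedModule) u n)) (sum_n B)
  (Cmod l) (Series B)).
- intros n. induction n as [|n IH]; [rewrite !sum_O; apply HB|].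
  rewrite !sum_Sn.
  change (Cmod (sum_n (G := C_NormedModule) u n + u (S n))%C
          <= sum_n B n + B (S n)).
  eapply Rle_trans; [apply Cmod_triangle|]. specialize (HB (S n)). lra.
- exact (filterlim_comp _ _ _ _ _ eventually _ _ Hu
    (filterlim_norm (V := C_NormedModule) l)).
- exact (Series_correct B HsB).
Qed.

(** Were the radius [R0] below 1, the series would converge at a real point strictly between [R0]
    and 1, so its terms would tend to 0 there, which is impossible outside the disk of
    convergence. *)
Lemma radius_ge_1_intro (b : nat -> C) (F : C -> C) :
  (forall z, disk z -> cseries (fun k => b k * z ^ k)%C (F z)) -> radius_ge_1 b.
Proof.
intros H. apply Rbar_not_lt_le. intros Hlt.
assert (Hge := CV_radius_ge_0 (fun k => Cmod (b k))).
destruct (CV_radius (fun k => Cmod (b k))) as [R0| |] eqn:E;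
  simpl in Hlt, Hge; try easy.
set (r := (R0 + 1) / 2).
assert (Hr : R0 < r < 1) by (unfold r; lra).
assert (Hr' : Rabs r = r) by (apply Rabs_pos_eq; lra).
apply (CV_disk_outside (fun k => Cmod (b k)) r); [now rewrite E, Hr'|].
assert (Hd : disk r) by (unfold disk; rewrite Cmod_R; lra).
apply is_lim_seq_ext with (2 := cseries_lim_0 _ _ (H r Hd)).
intros k. rewrite Cmod_mult, Cmod_pow, Cmod_R, Hr'. reflexivity.
Qed.

Lemma radius_ge_1_cshift (b : nat -> C) : radius_ge_1 b -> radius_ge_1 (cshift b).
Proof.
unfold radius_ge_1. rewrite <- (CV_radius_decr_1 (fun k => Cmod (b k))).
exact (fun H => H).
Qed.

Lemma radius_ge_1_cderive (b : nat -> C) : radius_ge_1 b -> radius_ge_1 (cderive b).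
Proof.
unfold radius_ge_1. rewrite <- (CV_radius_derive (fun k => Cmod (b k))).
intros H. erewrite CV_radius_ext; [exact H|].
intros k. unfold cderive, PS_derive.
rewrite Cmod_mult, Cmod_R, Rabs_pos_eq; [reflexivity | apply pos_INR].
Qed.

Lemma radius_ge_1_series (b : nat -> C) (r : R) :
  radius_ge_1 b -> 0 <= r < 1 -> ex_series (fun k => Cmod (b k) * r ^ k).
Proof.
intros Hb Hr.
eapply ex_series_ext; [|apply (CV_disk_inside (fun k => Cmod (b k)) r)].
- intros k. simpl. rewrite Rabs_pos_eq; [reflexivity|].
  apply Rmult_le_pos; [apply Cmod_ge_0 | apply pow_le; lra].
- rewrite Rabs_pos_eq by lra.
  eapply Rbar_lt_le_trans; [|exact Hb]. simpl. lra.
Qed.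

Lemma psum_correct (b : nat -> C) (z : C) :
  radius_ge_1 b -> disk z -> cseries (fun k => b k * z ^ k)%C (psum b z).
Proof.
intros Hb Hz. unfold psum. apply epsilon_spec.
apply (ex_series_le (V := C_CompleteNormedModule) _ (fun k => Cmod (b k) * Cmod z ^ k)).
- intros k. change (Cmod (b k * z ^ k)%C <= Cmod (b k) * Cmod z ^ k).
  rewrite Cmod_mult, Cmod_pow. apply Rle_refl.
- apply radius_ge_1_series; [exact Hb|]. split; [apply Cmod_ge_0 | exact Hz].
Qed.

Lemma psum_unique (b : nat -> C) (z l : C) :
  cseries (fun k => b k * z ^ k)%C l -> psum b z = l.
Proof.
intros H. apply (cseries_unique (fun k => b k * z ^ k)%C); [|exact H].
unfold psum. apply epsilon_spec. now exists l.
Qed.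

Lemma cseries_cshift (u : nat -> C) (l : C) :
  cseries u l -> cseries (fun k => u (S k)) (l - u 0%nat).
Proof.
intros H. apply (is_series_incr_1 (V := C_NormedModule)).
change (cseries u (l - u 0%nat + u 0%nat)).
now replace (l - u 0%nat + u 0%nat)%C with l by ring.
Qed.

Lemma cseries_scal (c : C) (u : nat -> C) (l : C) :
  cseries u l -> cseries (fun k => c * u k)%C (c * l).
Proof. exact (is_series_scal (V := C_NormedModule) c u l). Qed.

Lemma cseries_minus (u v : nat -> C) (l m : C) :
  cseries u l -> cseries v m -> cseries (fun k => u k - v k)%C (l - m).
Proof. exact (is_series_minus (V := C_NormedModule) u v l m). Qed.

Lemma cseries_ext (u v : nat -> C) (l : C) :
  (forall k, u k = v k) -> cseries u l -> cseries v l.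
Proof. exact (is_series_ext (V := C_NormedModule) u v l). Qed.

Lemma psum_head (b : nat -> C) (z : C) :
  radius_ge_1 b -> disk z -> psum b z = (b 0%nat + z * psum (cshift b) z)%C.
Proof.
intros Hb Hz.
assert (H1 := cseries_cshift _ _ (psum_correct b z Hb Hz)).
assert (H2 := cseries_scal z _ _
  (psum_correct _ z (radius_ge_1_cshift b Hb) Hz)).
assert (E : (psum b z - b 0%nat * z ^ 0)%C = (z * psum (cshift b) z)%C).
{ apply (cseries_unique _ _ _ H1). revert H2. apply cseries_ext.
  intros k. unfold cshift. rewrite Cpow_S. ring. }
rewrite <- E. simpl. ring.
Qed.

Lemma psum_factor (m : nat) (b : nat -> C) (z : C) :
  radius_ge_1 b -> disk z -> (forall k, (k < m)%nat -> b k = RtoC 0) ->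
  psum b z = (z ^ m * psum (fun k => b (k + m)%nat) z)%C.
Proof.
intros Hb Hz. revert b Hb. induction m as [|m IH]; intros b Hb H0.
- simpl. rewrite Cmult_1_l. f_equal.
  apply functional_extensionality. intros k. now rewrite Nat.add_0_r.
- rewrite psum_head by assumption.
  rewrite H0, (IH (cshift b)), Cpow_S by
    (try apply radius_ge_1_cshift; try (intros k Hk; apply H0); auto; lia).
  replace (fun k => cshift b (k + m)) with (fun k => b (k + S m)%nat); [ring|].
  apply functional_extensionality. intros k. unfold cshift. f_equal. lia.
Qed.

Lemma radius_ge_1_shift (m : nat) (b : nat -> C) :
  radius_ge_1 b -> radius_ge_1 (fun k => b (k + m)%nat).
Proof.
revert b. induction m as [|m IH]; intros b Hb.
- replace (fun k => b (k + 0)%nat) with b; [exact Hb|].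
  apply functional_extensionality. intros k. now rewrite Nat.add_0_r.
- replace (fun k => b (k + S m)%nat) with (fun k => cshift b (k + m)).
  + apply IH, radius_ge_1_cshift, Hb.
  + apply functional_extensionality. intros k. unfold cshift. f_equal. lia.
Qed.

Lemma psum_0 (b : nat -> C) : radius_ge_1 b -> psum b 0 = b 0%nat.
Proof.
intros Hb. rewrite psum_head; [ring | exact Hb |].
unfold disk. rewrite Cmod_0. lra.
Qed.

(** The factor [(k + 2) (k + 1) rho^k] is the one that two formal differentiations produce, so
    summation against the coefficients is controlled by the twice derived series at [rho]. *)
Lemma pow_taylor_bound (z s : C) (rho : R) (k : nat) :
  Cmod z + Cmod s <= rho ->
  Cmod ((z + s) ^ S (S k) - z ^ S (S k) - s * (INR (S (S k)) * z ^ S k))%C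
  <= Cmod s ^ 2 * (INR (S (S k)) * INR (S k) * rho ^ k).
Proof.
intros Hrho.
assert (Hz := Cmod_ge_0 z). assert (Hs := Cmod_ge_0 s).
induction k as [|k IH].
- replace ((z + s) ^ 2 - z ^ 2 - s * (INR 2 * z ^ 1))%C with (s ^ 2)%C
    by (simpl INR; rewrite RtoC_plus; simpl; ring).
  rewrite Cmod_pow. simpl. nra.
- set (E := ((z + s) ^ S (S k) - z ^ S (S k) - s * (INR (S (S k)) * z ^ S k))%C) in *.
  replace ((z + s) ^ S (S (S k)) - z ^ S (S (S k))
            - s * (INR (S (S (S k))) * z ^ S (S k)))%C
    with ((z + s) * E + s ^ 2 * (INR (S (S k)) * z ^ S k))%C
    by (unfold E; rewrite (S_INR (S (S k))), RtoC_plus, !Cpow_S; ring).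
  eapply Rle_trans; [apply Cmod_triangle|].
  rewrite !Cmod_mult, !Cmod_pow, Cmod_R, (Rabs_pos_eq (INR _)) by apply pos_INR.
  assert (H1 : Cmod (z + s)%C <= rho) by (eapply Rle_trans; [apply Cmod_triangle|exact Hrho]).
  assert (H2 : Cmod z ^ S k <= rho ^ S k) by (apply pow_incr; lra).
  assert (H3 : Cmod (z + s)%C * Cmod E <=
    rho * (Cmod s ^ 2 * (INR (S (S k)) * INR (S k) * rho ^ k))).
  { apply Rmult_le_compat; auto using Cmod_ge_0. }
  assert (H4 : 0 <= INR (S (S k))) by apply pos_INR.
  assert (H5 : 0 <= Cmod s ^ 2) by apply pow2_ge_0.
  assert (H6 : Cmod s ^ 2 * (INR (S (S k)) * Cmod z ^ S k)
             <= Cmod s ^ 2 * (INR (S (S k)) * rho ^ S k))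
    by (apply Rmult_le_compat_l; [|apply Rmult_le_compat_l]; assumption).
  assert (H7 : 0 <= rho ^ S k) by (apply pow_le; lra).
  eapply Rle_trans; [apply Rplus_le_compat; eassumption|].
  replace (rho * (Cmod s ^ 2 * (INR (S (S k)) * INR (S k) * rho ^ k))
           + Cmod s ^ 2 * (INR (S (S k)) * rho ^ S k))
    with (Cmod s ^ 2 * (INR (S (S k)) * (INR (S k) + 1) * rho ^ S k))
    by (simpl; ring).
  apply Rmult_le_compat_l; [assumption|].
  apply Rmult_le_compat_r; [assumption|].
  rewrite (S_INR (S (S k))), <- S_INR. nra.
Qed.

(** Termwise differentiation: the second-order remainder is at most [M |s|^2], where [M] sums the
    moduli of the twice derived series at a radius [rho] between [|z|] and 1. *)
Lemma psum_derive (b : nat -> C) (z : C) :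
  radius_ge_1 b -> disk z -> cd (psum b) z (psum (cderive b) z).
Proof.
intros Hb Hz. unfold disk in Hz.
assert (Hb1 := radius_ge_1_cderive _ Hb).
assert (Hb2 := radius_ge_1_cderive _ Hb1).
assert (Hz0 := Cmod_ge_0 z).
set (rho := (Cmod z + 1) / 2).
assert (Hrho : Cmod z < rho < 1) by (unfold rho; lra).
assert (HS := radius_ge_1_series _ rho Hb2 ltac:(lra)).
set (M := Series (fun k => Cmod (cderive (cderive b) k) * rho ^ k)) in *.
assert (HM : 0 <= M).
{ assert (Hr : Cmod rho = rho) by (rewrite Cmod_R; apply Rabs_pos_eq; lra).
  assert (Hd : disk rho) by (unfold disk; rewrite Hr; apply Hrho).
  eapply Rle_trans; [apply Cmod_ge_0|].
  refine (cseries_norm_le _ _ _ _ HS (psum_correct _ _ Hb2 Hd)).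
  intros k. rewrite Cmod_mult, Cmod_pow, Hr. apply Rle_refl. }
apply cd_def. intros eps Heps.
exists (Rmin (rho - Cmod z) (eps / (M + 1))). split.
{ apply Rmin_pos; [lra|]. apply Rdiv_lt_0_compat; lra. }
intros s Hs.
assert (Hs1 : Cmod z + Cmod s <= rho).
{ generalize (Rmin_l (rho - Cmod z) (eps / (M + 1))). lra. }
assert (Hs2 : Cmod s * (M + 1) <= eps).
{ apply Rle_div_r; [lra|].
  generalize (Rmin_r (rho - Cmod z) (eps / (M + 1))). lra. }
assert (Hs0 := Cmod_ge_0 s).
assert (Hzs : disk (z + s)%C).
{ unfold disk. generalize (Cmod_triangle z s). lra. }
enough (Cmod (psum b (z + s) - psum b z - s * psum (cderive b) z)%C
        <= Cmod s ^ 2 * M) by nra.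
(* Two shifts remove the terms of order 0 and 1, on which the remainder vanishes; what is left is
   estimated term by term. *)
assert (H1 := cseries_cshift _ _
  (cseries_minus _ _ _ _ (psum_correct b _ Hb Hzs) (psum_correct b _ Hb Hz))).
assert (H2 := cseries_scal s _ _ (psum_correct _ z Hb1 Hz)).
assert (H3 := cseries_cshift _ _ (cseries_minus _ _ _ _ H1 H2)).
unfold M. rewrite <- Series_scal_l.
match type of H3 with is_series _ ?l =>
  replace (psum b (z + s) - psum b z - s * psum (cderive b) z)%C with l
    by (unfold cderive; simpl; ring) end.
refine (cseries_norm_le _ _ _ _ _ H3).
- intros k.
  replace (b (S (S k)) * (z + s) ^ S (S k) - b (S (S k)) * z ^ S (S k)
           - s * (cderive b (S k) * z ^ S k))%C
    with (b (S (S k)) *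
      ((z + s) ^ S (S k) - z ^ S (S k) - s * (INR (S (S k)) * z ^ S k)))%C
    by (unfold cderive; ring).
  unfold cderive.
  rewrite !Cmod_mult, !Cmod_R, !(Rabs_pos_eq (INR _)) by apply pos_INR.
  assert (Hp := pow_taylor_bound z s rho k Hs1).
  apply Rle_trans with (Cmod (b (S (S k))) *
    (Cmod s ^ 2 * (INR (S (S k)) * INR (S k) * rho ^ k))).
  + apply Rmult_le_compat_l; [apply Cmod_ge_0 | exact Hp].
  + apply Req_le. ring.
- exact (ex_series_scal (V := R_NormedModule) (Cmod s ^ 2) _ HS).
Qed.

(** * Real derivatives along lines *)

Lemma is_derive_along_line (p : C -> R) (f : C -> C) (z e l : C) (t : R) :
  (p = Re \/ p = Im) -> cd f (z + t * e) l ->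
  is_derive (fun x : R => p (f (z + x * e)%C)) t (p (l * e)%C).
Proof.
intros Hp Hf. split; [apply is_linear_scal_l|].
intros x Hx. apply (is_filter_lim_locally_unique (V := R_NormedModule)) in Hx.
subst x. intros eps.
assert (He := Cmod_ge_0 e).
destruct (proj1 (cd_def _ _ _) Hf (eps / (Cmod e + 1))) as [d [Hd0 Hd]].
{ apply Rdiv_lt_0_compat; [apply cond_pos | lra]. }
assert (Hd' : 0 < d / (Cmod e + 1)) by (apply Rdiv_lt_0_compat; lra).
exists (mkposreal _ Hd'). intros y Hy.
change (Rabs (y - t) < d / (Cmod e + 1)) in Hy.
change (Rabs (p (f (z + y * e)%C) - p (f (z + t * e)%C) - (y - t) * p (l * e)%C)
        <= eps * Rabs (y - t)).
apply Rlt_div_r in Hy; [|lra].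
set (s := (RtoC (y - t) * e)%C).
assert (Hs : Cmod s = Rabs (y - t) * Cmod e) by (unfold s; rewrite Cmod_mult, Cmod_R; ring).
assert (Hyt := Rabs_pos (y - t)).
specialize (Hd s ltac:(rewrite Hs; nra)).
replace (z + t * e + s)%C with (z + y * e)%C in Hd
  by (unfold s; rewrite RtoC_minus; ring).
replace (p (f (z + y * e)%C) - p (f (z + t * e)%C) - (y - t) * p (l * e)%C)
  with (p (f (z + y * e) - f (z + t * e) - s * l)%C).
- assert (Hpa : forall w : C, Rabs (p w) <= Cmod w).
  { intros w. eapply Rle_trans; [|apply Rmax_Cmod].
    destruct Hp as [-> | ->]; [apply Rmax_l | apply Rmax_r]. }
  eapply Rle_trans; [apply Hpa|]. eapply Rle_trans; [exact Hd|]. rewrite Hs.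
  unfold Rdiv. rewrite Rmult_assoc. apply Rmult_le_compat_l; [apply Rlt_le, cond_pos|].
  apply Rmult_le_reg_l with (Cmod e + 1); [lra|].
  rewrite <- Rmult_assoc, Rinv_r, Rmult_1_l by lra. nra.
- unfold s. generalize (f (z + y * e)%C) (f (z + t * e)%C). intros [a1 a2] [b1 b2].
  destruct l, e, Hp as [-> | ->]; simpl; ring.
Qed.

(** [Re (conj f * g)] is the inner product of the plane. With [g = f] it yields the derivative of
    [|f|^2]; with [g] built from the derivative of [f] it allows a second differentiation. *)
Lemma is_derive_Cdot_line (f g : C -> C) (z e l m : C) (t : R) :
  cd f (z + t * e) l -> cd g (z + t * e) m ->
  is_derive (fun x : R => Re (Cconj (f (z + x * e)) * g (z + x * e))%C) t
    (Re (Cconj (l * e) * g (z + t * e))%C + Re (Cconj (f (z + t * e)) * (m * e))%C).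
Proof.
intros Hf Hg.
assert (H1 := is_derive_along_line Re f z e l t (or_introl eq_refl) Hf).
assert (H2 := is_derive_along_line Im f z e l t (or_intror eq_refl) Hf).
assert (H3 := is_derive_along_line Re g z e m t (or_introl eq_refl) Hg).
assert (H4 := is_derive_along_line Im g z e m t (or_intror eq_refl) Hg).
apply is_derive_ext with
  (fun x : R => Re (f (z + x * e)%C) * Re (g (z + x * e)%C)
                + Im (f (z + x * e)%C) * Im (g (z + x * e)%C)).
{ intros x. generalize (f (z + x * e)%C) (g (z + x * e)%C).
  intros [] []. simpl. ring. }
evar_last.
- apply (is_derive_plus (V := R_NormedModule)).
  + exact (is_derive_mult _ _ t _ _ H1 H3 Rmult_comm).
  + exact (is_derive_mult _ _ t _ _ H2 H4 Rmult_comm).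
- cbv beta. generalize (f (z + t * e)%C) (g (z + t * e)%C).
  intros [] []. destruct l, m, e. unfold plus, mult; simpl. ring.
Qed.

Lemma is_derive_Cmod2_line (f : C -> C) (z e l : C) (t : R) :
  cd f (z + t * e) l ->
  is_derive (fun x : R => Cmod (f (z + x * e)%C) ^ 2) t
    (2 * Re (Cconj (f (z + t * e)) * (l * e))%C).
Proof.
intros Hf.
eapply is_derive_ext; [|evar_last; [exact (is_derive_Cdot_line f f z e l l t Hf Hf)|]].
- intros x. cbv beta. rewrite Cmod2_alt. generalize (f (z + x * e)%C).
  intros []. simpl. ring.
- generalize (f (z + t * e)%C). intros []. destruct l, e. simpl. ring.
Qed.

(** No critical point is assumed: a nonnegative slope at 0 with positive second derivative makes
    [F1] positive just to the right of 0, and the mean value theorem then makes [F] grow. *)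
Lemma second_derivative_test_right (F F1 : R -> R) (L r : R) :
  0 < r -> 0 < L -> 0 <= F1 0 ->
  (forall t, Rabs t < r -> is_derive F t (F1 t)) -> is_derive F1 0 L ->
  exists t, Rabs t < r /\ F 0 < F t.
Proof.
intros Hr HL H0 HF HF1. apply is_derive_Reals in HF1.
destruct (HF1 (L / 2) ltac:(lra)) as [d Hd].
assert (Hd0 := cond_pos d).
set (m := Rmin r d / 2).
assert (Hm : 0 < m /\ m < r /\ m < d).
{ generalize (Rmin_l r d) (Rmin_r r d) (Rmin_pos r d Hr Hd0). unfold m. lra. }
exists m. split; [rewrite Rabs_pos_eq; lra|].
destruct (MVT_cor2 F F1 0 m) as [c [E Hc]]; [lra| |].
- intros t Ht. apply is_derive_Reals, HF. rewrite Rabs_pos_eq; lra.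
- specialize (Hd c ltac:(lra) ltac:(rewrite Rabs_pos_eq; lra)).
  rewrite Rplus_0_l in Hd. apply Rabs_lt_between in Hd.
  assert (Hq : L / 2 < (F1 c - F1 0) / c) by lra.
  apply Rlt_div_r in Hq; [|lra].
  assert (0 < L * c) by (apply Rmult_lt_0_compat; lra).
  assert (0 < F1 c * (m - 0)) by (apply Rmult_lt_0_compat; lra). lra.
Qed.

Lemma is_derive_comp_opp (F : R -> R) (t l : R) :
  is_derive F (- t) l -> is_derive (fun x => F (- x)) t (- l).
Proof.
intros H. evar_last.
- apply (is_derive_comp F Ropp t); [exact H|].
  instantiate (1 := -1). auto_derive; auto; ring.
- unfold scal; simpl; unfold mult; simpl. ring.
Qed.

(** A negative slope at 0 becomes positive under [t -> - t], which preserves the second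
    derivative. *)
Lemma second_derivative_test (F F1 : R -> R) (L r : R) :
  0 < r -> 0 < L ->
  (forall t, Rabs t < r -> is_derive F t (F1 t)) -> is_derive F1 0 L ->
  exists t, Rabs t < r /\ F 0 < F t.
Proof.
intros Hr HL HF HF1. destruct (Rle_dec 0 (F1 0)) as [H0|H0].
- now apply second_derivative_test_right with F1 L.
- destruct (second_derivative_test_right (fun t => F (- t)) (fun t => - F1 (- t)) L r)
    as [t [Ht Hlt]]; [exact Hr | exact HL | rewrite Ropp_0; lra | | |].
  + intros t Ht. apply is_derive_comp_opp, HF. now rewrite Rabs_Ropp.
  + replace L with (- - L) by ring.
    apply (is_derive_opp (fun t => F1 (- t))), is_derive_comp_opp.
    now rewrite Ropp_0.
  + exists (- t). rewrite Rabs_Ropp. split; [exact Ht|].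
    now rewrite Ropp_0 in Hlt.
Qed.

(** * Compactness and the maximum principle *)

Notation ccontinuous f z :=
  (@continuous C_UniformSpace R_UniformSpace f (z%C : C)).
Notation clocally z P := (@locally C_UniformSpace (z%C : C) P).

(** A Lebesgue-number argument: choice turns the local radii into a gauge on a square containing the
    closed disk, compactness gives a positive lower bound for the gauges that are needed, and [P]
    passes to smaller [d]. *)
Lemma locally_uniform (B : R) (P : R -> C -> Prop) :
  (forall d d' z, 0 < d <= d' -> P d' z -> P d z) ->
  (forall z, exists d, 0 < d /\ clocally z (P d)) ->
  exists d, 0 < d /\ forall z, Cmod z <= B -> P d z.
Proof.
intros Hmono Hloc.
assert (H : forall u v : R, {d : posreal |
  forall z : C, Rabs (fst z - u) < d -> Rabs (snd z - v) < d -> P d z}).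
{ intros u v. apply constructive_indefinite_description.
  destruct (Hloc (u, v)) as [d [Hd [r Hr]]].
  assert (Hm : 0 < Rmin d r) by (apply Rmin_pos; [exact Hd | apply cond_pos]).
  exists (mkposreal _ Hm). intros z Hu Hv. simpl in *.
  apply Hmono with d; [split; [exact Hm | apply Rmin_l]|].
  apply Hr. split; [eapply Rlt_le_trans; [exact Hu|] |
    eapply Rlt_le_trans; [exact Hv|]]; apply Rmin_r. }
destruct (compactness_value_2d (- B) B (- B) B (fun u v => proj1_sig (H u v)))
  as [d Hd].
exists d. split; [apply cond_pos|]. intros z Hz. apply NNPP. intros HP.
assert (Hm := Rmax_Cmod z).
assert (H1 : Rabs (fst z) <= B) by (generalize (Rmax_l (Rabs (fst z)) (Rabs (snd z))); lra).
assert (H2 : Rabs (snd z) <= B) by (generalize (Rmax_r (Rabs (fst z)) (Rabs (snd z))); lra).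
apply Rabs_le_between in H1. apply Rabs_le_between in H2.
apply (Hd _ _ H1 H2). intros [u [v [_ [_ [Hu [Hv Hle]]]]]].
apply HP. destruct (H u v) as [r Hr]; simpl in *.
apply Hmono with r; [split; [apply cond_pos | exact Hle]|]. now apply Hr.
Qed.

Lemma ccontinuous_lt (u : C -> R) (z : C) (M : R) :
  ccontinuous u z -> u z < M -> clocally z (fun y => u y < M).
Proof.
intros Hu Hlt. apply (Hu (fun t => t < M)). exact (open_lt M (u z) Hlt).
Qed.

(** The extreme value theorem, by applying local-to-uniform compactness twice: with [t <= / d] it
    bounds [u] above, and with [t <= M - d] it contradicts that [M] is the supremum if [M] is not
    attained. *)
Lemma compact_max (K : C -> Prop) (u : C -> R) (B : R) :
  (forall z, K z -> Cmod z <= B) ->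
  (forall z, ~ K z -> clocally z (fun y => ~ K y)) ->
  (forall z, K z -> ccontinuous u z) ->
  (exists z, K z) ->
  exists z, K z /\ forall y, K y -> u y <= u z.
Proof.
intros HB HK Hu [z0 Hz0].
assert (Hunif : forall P : R -> R -> Prop,
  (forall d d' t, 0 < d <= d' -> P d' t -> P d t) ->
  (forall z, K z -> exists d M, 0 < d /\ u z < M /\ forall t, t < M -> P d t) ->
  exists d, 0 < d /\ forall z, K z -> P d (u z)).
{ intros P Hmono HP.
  destruct (locally_uniform B (fun d z => K z -> P d (u z))) as [d [Hd H]].
  - intros d d' z Hd H Hz. apply Hmono with d'; auto.
  - intros z. destruct (classic (K z)) as [Hz|Hz].
    + destruct (HP z Hz) as [d [M [Hd [Hlt HM]]]]. exists d. split; [exact Hd|].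
      apply filter_imp with (2 := ccontinuous_lt u z M (Hu z Hz) Hlt). auto.
    + exists 1. split; [lra|]. apply filter_imp with (2 := HK z Hz). tauto.
  - exists d. split; [exact Hd|]. intros z Hz. apply H; auto. }
destruct (Hunif (fun d t => t <= / d)) as [d [Hd Hbd]].
{ intros d d' t Hd H. apply Rle_trans with (/ d'); [exact H|].
  apply Rinv_le_contravar; lra. }
{ intros z _. assert (Ha := Rabs_pos (u z)).
  exists (/ (Rabs (u z) + 1)), (Rabs (u z) + 1). split; [|split].
  - apply Rinv_0_lt_compat. lra.
  - generalize (Rle_abs (u z)). lra.
  - intros t Ht. rewrite Rinv_inv. lra. }
destruct (completeness (fun t => exists z, K z /\ t = u z)) as [M [HM1 HM2]].
{ exists (/ d). intros t [z [Hz ->]]. auto. }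
{ now exists (u z0), z0. }
apply NNPP. intros Hno.
assert (Hlt : forall z, K z -> u z < M).
{ intros z Hz. apply Rnot_le_lt. intros Hle. apply Hno. exists z.
  split; [exact Hz|]. intros y Hy. apply Rle_trans with M; [|exact Hle].
  apply HM1. now exists y. }
destruct (Hunif (fun d t => t <= M - d)) as [d' [Hd' Hbd']].
{ intros. lra. }
{ intros z Hz. specialize (Hlt z Hz).
  exists ((M - u z) / 2), ((M + u z) / 2). repeat split; try intros t Ht; lra. }
enough (M <= M - d') by lra.
apply HM2. intros t [z [Hz ->]]. auto.
Qed.

Lemma ccontinuous_Cmod2 (f : C -> C) (z l : C) :
  cd f z l -> ccontinuous (fun y => Cmod (f y) ^ 2) z.
Proof.
intros H. apply (continuous_comp (U := C_UniformSpace) (fun y => Cmod (f y)) (fun t => t ^ 2)).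
- apply continuous_Cmod, (cd_continuous f z l H).
- apply (ex_derive_continuous (V := R_NormedModule)). auto_derive. auto.
Qed.

Lemma clocally_Cmod (z : C) (r : R) : 0 < r -> clocally z (fun y => Cmod (y - z)%C < r).
Proof.
intros Hr. apply locally_C.
exists (mkposreal r Hr). intros y Hy. exact Hy.
Qed.

Lemma clocally_Cmod_gt (z : C) (r : R) : r < Cmod z -> clocally z (fun y => r < Cmod y).
Proof.
intros H. apply filter_imp with (2 := clocally_Cmod z (Cmod z - r) ltac:(lra)).
intros y Hy. generalize (Cmod_triangle y (- (y - z))). rewrite Cmod_opp.
replace (y + - (y - z))%C with z by ring. lra.
Qed.

(* At an interior maximum of [|g|^2 + eps |z|^2] the second derivatives in the
   directions [1] and [i] would add up to [4 (|g'|^2 + eps) > 0]. *)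
Lemma no_interior_max (g g1 : C -> C) (g2 z : C) (r eps : R) :
  0 < r -> 0 < eps ->
  (forall y, Cmod (y - z)%C < r -> cd g y (g1 y)) -> cd g1 z g2 ->
  exists y, Cmod (y - z)%C < r /\
    Cmod (g z) ^ 2 + eps * Cmod z ^ 2 < Cmod (g y) ^ 2 + eps * Cmod y ^ 2.
Proof.
intros Hr Heps Hg Hg1.
(* [L e] is the second derivative at [t = 0] of [|g|^2 + eps |z|^2] along [z + t e]. The [g2] term
   changes sign from [e = 1] to [e = i], so one of the two values is positive. *)
set (L e := 2 * (Cmod (g1 z * e)%C ^ 2 + Re (Cconj (g z) * (g2 * e * e))%C
                 + eps * Cmod e ^ 2)).
assert (Hdir : forall e : C, Cmod e = 1 -> 0 < L e ->
  exists y, Cmod (y - z)%C < r /\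
    Cmod (g z) ^ 2 + eps * Cmod z ^ 2 < Cmod (g y) ^ 2 + eps * Cmod y ^ 2).
{ intros e He HL.
  destruct (second_derivative_test
    (fun t => Cmod (g (z + t * e)%C) ^ 2 + eps * Cmod (z + t * e)%C ^ 2)
    (fun t => 2 * Re (Cconj (g (z + t * e)) * (g1 (z + t * e) * e))%C
              + eps * (2 * Re (Cconj (z + t * e) * (1 * e))%C))
    (L e) r Hr HL) as [t [Ht Hlt]].
  - intros t Ht. apply (is_derive_plus (V := R_NormedModule)).
    + apply is_derive_Cmod2_line, Hg.
      replace (z + t * e - z)%C with (t * e)%C by ring.
      rewrite Cmod_mult, Cmod_R, He. lra.
    + apply is_derive_scal, (is_derive_Cmod2_line (fun y => y)), cd_id.
  - evar_last.
    + apply (is_derive_plus (V := R_NormedModule)).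
      * apply is_derive_scal, (is_derive_Cdot_line g (fun y => (g1 y * e)%C) z e (g1 z) (g2 * e)).
        -- rewrite Cmult_0_l, Cplus_0_r. apply Hg.
           replace (z - z)%C with (RtoC 0) by ring. now rewrite Cmod_0.
        -- rewrite Cmult_0_l, Cplus_0_r. eapply cd_eq.
           ++ apply cd_mult; [exact Hg1 | apply cd_const].
           ++ cbv beta. ring.
      * apply is_derive_scal, is_derive_scal,
          (is_derive_Cdot_line (fun y => y) (fun y => (1 * e)%C) z e 1 0).
        -- apply cd_id.
        -- apply cd_const.
    + unfold L. rewrite !Cmod2_alt, Cmult_0_l, Cplus_0_r.
      generalize (g z) (g1 z). intros [] []. clear. destruct z, g2, e.
      unfold plus; simpl. ring.
  - exists (z + t * e)%C. split.
    + replace (z + t * e - z)%C with (t * e)%C by ring.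
      rewrite Cmod_mult, Cmod_R, He. lra.
    + now replace (z + 0 * e)%C with z in Hlt by ring. }
destruct (Rlt_dec 0 (L 1%C)) as [H|H]; [apply (Hdir 1%C); [apply Cmod_1 | exact H]|].
apply (Hdir Ci); [apply Cmod_Ci|].
unfold L in *. rewrite !Cmod_mult, ?Cmod_1, ?Cmod_Ci in *.
replace (g2 * Ci * Ci)%C with (- (g2 * 1 * 1))%C
  by (destruct g2; unfold Ci; apply injective_projections; simpl; ring).
assert (E : Re (Cconj (g z) * - (g2 * 1 * 1))%C = - Re (Cconj (g z) * (g2 * 1 * 1))%C).
{ generalize (Cconj (g z)). intros []; destruct g2; simpl; ring. }
rewrite E. generalize (pow2_ge_0 (Cmod (g1 z))). nra.
Qed.

(** The maximum of [|g|^2 + eps |z|^2] over the closed disk can only lie on the circle. There the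
    perturbation equals [eps r^2 = e], which is arbitrarily small. *)
Lemma maximum_principle (g g1 : C -> C) (r M : R) :
  0 < r ->
  (forall z, Cmod z < r -> cd g z (g1 z)) ->
  (forall z, Cmod z < r -> exists m, cd g1 z m) ->
  (forall z, Cmod z = r -> exists l, cd g z l) ->
  (forall z, Cmod z = r -> Cmod (g z) ^ 2 <= M) ->
  forall z, Cmod z < r -> Cmod (g z) ^ 2 <= M.
Proof.
intros Hr Hg Hg1 Hgr HM z Hz. apply le_epsilon. intros e He.
set (eps := e / r ^ 2).
assert (Heps : 0 < eps) by (apply Rdiv_lt_0_compat; [exact He | now apply pow_lt]).
destruct (compact_max (fun y => Cmod y <= r)
  (fun y => Cmod (g y) ^ 2 + eps * Cmod y ^ 2) r) as [y [Hy Hmax]].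
- auto.
- intros y Hy. apply filter_imp with (2 := clocally_Cmod_gt y r (Rnot_le_lt _ _ Hy)).
  intros. lra.
- intros y Hy. apply (continuous_plus (V := R_NormedModule) (U := C_UniformSpace)).
  + destruct (Rle_lt_or_eq_dec _ _ Hy) as [Hlt|E].
    * apply (ccontinuous_Cmod2 g y (g1 y)); auto.
    * destruct (Hgr y E) as [l Hl]. now apply (ccontinuous_Cmod2 g y l).
  + apply (continuous_scal_r (V := R_NormedModule) (U := C_UniformSpace)).
    exact (ccontinuous_Cmod2 (fun x => x) y _ (cd_id y)).
- exists 0%C. rewrite Cmod_0. lra.
- assert (Hmaxz := Hmax z ltac:(lra)).
  assert (0 <= eps * Cmod z ^ 2) by (apply Rmult_le_pos; [lra | apply pow2_ge_0]).
  destruct (Rle_lt_or_eq_dec _ _ Hy) as [Hlt|E].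
  + exfalso. destruct (Hg1 y Hlt) as [m Hm].
    destruct (no_interior_max g g1 m y (r - Cmod y) eps)
      as [x [Hx Hx']]; auto; [lra| |].
    * intros x Hx. apply Hg. generalize (Cmod_triangle y (x - y)).
      replace (y + (x - y))%C with x by ring. lra.
    * apply (Rlt_irrefl (Cmod (g y) ^ 2 + eps * Cmod y ^ 2)).
      eapply Rlt_le_trans; [exact Hx'|]. apply Hmax.
      generalize (Cmod_triangle y (x - y)).
      replace (y + (x - y))%C with x by ring. lra.
  + specialize (HM y E). rewrite E in Hmaxz.
    assert (eps * r ^ 2 = e) by (unfold eps; field; lra). lra.
Qed.

(** * Jack's lemma *)

Lemma derive_le_of_le_right (F G : R -> R) (a b r : R) :
  0 < r -> (forall t, 0 < t < r -> F t <= G t) -> F 0 = G 0 ->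
  is_derive F 0 a -> is_derive G 0 b -> a <= b.
Proof.
intros Hr Hle H0 HF HG. apply le_epsilon. intros e He.
assert (HD := is_derive_minus (V := R_NormedModule) _ _ _ _ _ HG HF).
apply is_derive_Reals in HD. destruct (HD e He) as [d Hd].
assert (Hd0 := cond_pos d).
set (t := Rmin r d / 2).
assert (Ht : 0 < t /\ t < r /\ t < d).
{ generalize (Rmin_l r d) (Rmin_r r d) (Rmin_pos r d Hr Hd0). unfold t. lra. }
specialize (Hd t ltac:(lra) ltac:(rewrite Rabs_pos_eq; lra)).
unfold minus, plus, opp in Hd; simpl in Hd. rewrite Rplus_0_l, H0 in Hd.
specialize (Hle t ltac:(lra)).
assert (0 <= (G t + - F t - (G 0 + - G 0)) / t).
{ apply Rdiv_le_0_compat; lra. }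
apply Rabs_lt_between in Hd. lra.
Qed.

(** The maximum principle for [g = w / z^n] gives [|w| <= (|z| / r)^n] inside, with equality at
    [z0]. Comparing one-sided derivatives of both squared sides along each inward direction
    [z0 (-1 + i mu)] gives [n <= Re K + mu Im K] for every real [mu], where [K = z0 l / w(z0)]. This
    forces [Im K = 0] and [Re K >= n]. *)
Lemma jack (n : nat) (w g g1 : C -> C) (r : R) (z0 l : C) :
  0 < r ->
  (forall z, Cmod z <= r -> w z = (z ^ n * g z)%C) ->
  (forall z, Cmod z < r -> cd g z (g1 z)) ->
  (forall z, Cmod z < r -> exists m, cd g1 z m) ->
  (forall z, Cmod z = r -> exists m, cd g z m) ->
  (forall z, Cmod z = r -> Cmod (w z) <= 1) ->
  Cmod z0 = r -> Cmod (w z0) = 1 -> cd w z0 l ->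
  exists k : R, INR n <= k /\ (z0 * l)%C = (k * w z0)%C.
Proof.
intros Hr Hw Hg Hg1 Hgr Hw1 Hz0 Hwz0 Hl.
assert (Hrn : 0 < r ^ n) by now apply pow_lt.
assert (Hin : forall z, Cmod z < r -> Cmod (w z) ^ 2 <= ((Cmod z / r) ^ 2) ^ n).
{ intros z Hz.
  assert (HM : Cmod (g z) ^ 2 <= (/ r ^ n) ^ 2).
  { apply (maximum_principle g g1 r); auto.
    intros y Hy. specialize (Hw1 y Hy). rewrite Hw, Cmod_mult, Cmod_pow, Hy in Hw1 by lra.
    apply pow_incr. split; [apply Cmod_ge_0|].
    apply Rmult_le_reg_l with (r ^ n); [exact Hrn|]. rewrite Rinv_r by lra. exact Hw1. }
  rewrite Hw, Cmod_mult, Cmod_pow by lra. rewrite Rpow_mult_distr.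
  unfold Rdiv. rewrite Rpow_mult_distr, Rpow_mult_distr, <- !pow_mult, (Nat.mul_comm 2), !pow_mult, pow_inv.
  apply Rmult_le_compat_l; [apply pow2_ge_0 | exact HM]. }
assert (Hw0 : w z0 <> 0%C) by (apply Cmod_gt_0; lra).
set (K := (z0 * l / w z0)%C).
assert (HK : (z0 * l)%C = (K * w z0)%C) by (unfold K; field; exact Hw0).
assert (Hdir : forall mu : R, INR n <= Re K + mu * Im K).
{ intros mu. set (e := (-1, mu) : C).
  assert (Hmu := pow2_ge_0 mu).
  enough (2 * Re (Cconj (w z0) * (l * (z0 * e)))%C <= - 2 * INR n).
  { replace (Cconj (w z0) * (l * (z0 * e)))%C with (w z0 * Cconj (w z0) * (K * e))%C in H.
    - rewrite <- Cmod2_conj, Hwz0 in H. destruct K. unfold e in H. simpl in *. lra.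
    - replace (l * (z0 * e))%C with (z0 * l * e)%C by ring. rewrite HK. ring. }
  (* Here [|1 + t e|^2 = 1 - 2 t + (1 + mu^2) t^2], which is below 1 exactly for
     [0 < t < 2 / (1 + mu^2)]. *)
  apply (derive_le_of_le_right
    (fun t => Cmod (w (z0 + t * (z0 * e))%C) ^ 2)
    (fun t => ((1 - t) ^ 2 + (t * mu) ^ 2) ^ n) _ _ (2 / (1 + mu ^ 2))).
  - apply Rdiv_lt_0_compat; lra.
  - intros t [Ht0 Ht]. apply Rlt_div_r in Ht; [|lra].
    assert (E : Cmod (z0 + t * (z0 * e))%C = r * Cmod (1 + t * e)%C).
    { replace (z0 + t * (z0 * e))%C with (z0 * (1 + t * e))%C by ring.
      now rewrite Cmod_mult, Hz0. }
    assert (E2 : Cmod (1 + t * e)%C ^ 2 = (1 - t) ^ 2 + (t * mu) ^ 2).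
    { rewrite Cmod2_alt. unfold e. simpl. ring. }
    assert (Hlt : Cmod (1 + t * e)%C < 1).
    { apply Rsqr_incrst_0; [|apply Cmod_ge_0 | lra]. rewrite !Rsqr_pow2, E2. nra. }
    rewrite <- E2. replace (Cmod (1 + t * e)%C) with (Cmod (z0 + t * (z0 * e))%C / r).
    + apply Hin. rewrite E. nra.
    + rewrite E. field. lra.
  - rewrite Cmult_0_l, Cplus_0_r, Hwz0.
    replace ((1 - 0) ^ 2 + (0 * mu) ^ 2) with 1 by ring. now rewrite !pow1.
  - evar_last.
    + apply is_derive_Cmod2_line. rewrite Cmult_0_l, Cplus_0_r. exact Hl.
    + now rewrite Cmult_0_l, Cplus_0_r.
  - evar_last.
    + apply (is_derive_pow (fun t => (1 - t) ^ 2 + (t * mu) ^ 2) n 0 (-2)).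
      auto_derive; auto. ring.
    + cbv beta. replace ((1 - 0) ^ 2 + (0 * mu) ^ 2) with 1 by ring. rewrite pow1. ring. }
assert (HIm : Im K = 0).
(* This [mu] would make [Re K + mu Im K] equal to [n - 1]. *)
{ apply NNPP. intros Hne. specialize (Hdir ((INR n - Re K - 1) / Im K)).
  replace ((INR n - Re K - 1) / Im K * Im K) with (INR n - Re K - 1) in Hdir
    by (field; exact Hne). lra. }
exists (Re K). split; [specialize (Hdir 0); lra|].
rewrite HK. f_equal. destruct K. simpl in *. now rewrite HIm.
Qed.

Lemma clocally_Cmod_iff (z : C) (P : C -> Prop) :
  clocally z P <-> exists d, 0 < d /\ forall y, Cmod (y - z)%C < d -> P y.
Proof.
split.
- intros H. apply locally_C in H. destruct H as [d Hd].
  exists d. split; [apply cond_pos | exact Hd].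
- intros [d [Hd H]]. apply filter_imp with (2 := clocally_Cmod z d Hd). exact H.
Qed.

(** On the unit circle [1 / (1 - w)] has real part 1/2, and [lam^2 + 1 - 2 lam Re w] is
    [|lam - w|^2]; nothing else about [w] survives. *)
Lemma Re_boundary_value (p lam k : R) (w : C) :
  1 < lam -> Cmod w = 1 -> w <> RtoC 1 ->
  Re (p * (lam * (1 - w) / (lam - w)) + k * (w * (1 / (lam - w) - 1 / (1 - w))))%C
  = p * (lam + 1) / 2
    + (lam ^ 2 - 1) * (k - p * (lam - 1)) / (2 * (lam ^ 2 + 1 - 2 * lam * Re w)).
Proof.
intros Hlam Hw Hw1.
assert (Hn : Re w ^ 2 + Im w ^ 2 = 1) by (rewrite <- Cmod2_alt, Hw; ring).
destruct w as [c s]. simpl in Hn.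
change (Re (c, s)) with c.
assert (Hc : c < 1).
{ apply Rnot_le_lt. intros Hc. apply Hw1.
  assert (s = 0) by nra. assert (c = 1) by nra. subst. reflexivity. }
assert (HT : 0 < lam ^ 2 + 1 - 2 * lam * c) by nra.
assert (E1 : (lam - (c, s))%C <> 0%C).
{ intros E. apply (f_equal fst) in E. simpl in E. nra. }
assert (E2 : (1 - (c, s))%C <> 0%C).
{ intros E. apply (f_equal fst) in E. simpl in E. lra. }
assert (I1 : (/ (lam - (c, s)))%C = ((lam - c) / (lam ^ 2 + 1 - 2 * lam * c),
  s / (lam ^ 2 + 1 - 2 * lam * c))).
{ unfold Cinv, Cminus, Copp, Cplus. simpl.
  replace ((lam + - c) * ((lam + - c) * 1) + (0 + - s) * ((0 + - s) * 1))
    with (lam ^ 2 + 1 - 2 * lam * c) by nra.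
  f_equal; field; lra. }
assert (I2 : (/ (1 - (c, s)))%C = (1 / 2, s / (2 - 2 * c))).
{ unfold Cinv, Cminus, Copp, Cplus. simpl.
  replace ((1 + - c) * ((1 + - c) * 1) + (0 + - s) * ((0 + - s) * 1))
    with (2 - 2 * c) by nra.
  f_equal; field; lra. }
assert (Hs : s * s = 1 - c * c) by nra.
unfold Cdiv. rewrite I1, I2. simpl.
match goal with |- ?a = _ => replace a with
  (p * (lam * ((1 - c) * (lam - c) + s * s) / (lam ^ 2 + 1 - 2 * lam * c))
   + k * ((c * (lam - c) - s * s) / (lam ^ 2 + 1 - 2 * lam * c)
          - (c / 2 - s * s / (2 - 2 * c)))) by (field; lra) end.
rewrite Hs. field. lra.
Qed.

(** * The bound and the zeros of the derivative *)

(** This is what gives [lam > 1] in the theorem. A real square root forces [4 + n - 2 p > 0], so the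
    quotient may be cleared. *)
Lemma lambda1_ge_1 (p n : R) :
  1 <= p -> 1 <= n -> 0 <= disc1 p n -> 1 <= lambda1 p n.
Proof.
intros Hp Hn Hd. unfold lambda1.
assert (HS := sqrt_pos (disc1 p n)).
assert (HSS := sqrt_sqrt _ Hd).
assert (Hpos : 0 < 4 + n - 2 * p).
{ apply Rnot_le_lt. intros H. unfold disc1 in Hd. nra. }
apply Rle_div_r; [lra|].
(* The square of the right side exceeds the radicand by [32 (p - 1) (4 p + n - 2)], with equality at
   [p = 1]. *)
enough (sqrt (disc1 p n) <= n + 10 * p - 8) by lra.
apply Rsqr_incr_0_var; [|lra].
unfold Rsqr. rewrite HSS. unfold disc1. nra.
Qed.

(* The minimum over [c] is attained at [c = -1] or [c = 1] according to the
   sign of [n - p (lam - 1)]; the case distinction of [re_bound] is the same. *)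
Lemma re_bound_le (p n lam k c : R) :
  1 <= p -> 1 < lam -> n <= k -> -1 <= c < 1 ->
  re_bound p n lam <=
    p * (lam + 1) / 2
    + (lam ^ 2 - 1) * (k - p * (lam - 1)) / (2 * (lam ^ 2 + 1 - 2 * lam * c)).
Proof.
intros Hp Hlam Hk Hc.
set (T := lam ^ 2 + 1 - 2 * lam * c).
assert (HT1 : (lam - 1) ^ 2 < T) by (unfold T; nra).
assert (HT2 : T <= (lam + 1) ^ 2) by (unfold T; nra).
assert (HT0 : 0 < T) by nra.
assert (Hlp : 0 < lam ^ 2 - 1) by nra.
(* In both cases [re_bound] is the extreme value on the circle for [k = n], diminished by
   [(p - 1) (lam + 1) >= 0]; [Hq] absorbs this difference. *)
assert (Hq : forall q, 0 <= (p - 1) * (lam + 1) -> q <= (lam ^ 2 - 1) * (k - p * (lam - 1)) / (2 * T)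
   -> p * (lam + 1) / 2 + q - (p - 1) * (lam + 1) <=
      p * (lam + 1) / 2 + (lam ^ 2 - 1) * (k - p * (lam - 1)) / (2 * T)) by (intros; lra).
assert (Hp1 : 0 <= (p - 1) * (lam + 1)) by (apply Rmult_le_pos; lra).
assert (Hk' : (lam ^ 2 - 1) * (n - p * (lam - 1)) / (2 * T)
              <= (lam ^ 2 - 1) * (k - p * (lam - 1)) / (2 * T)).
{ apply Rmult_le_compat_r; [apply Rlt_le, Rinv_0_lt_compat; lra|].
  apply Rmult_le_compat_l; lra. }
unfold re_bound. destruct Rle_dec as [H|H].
- assert (Hn : p * (lam - 1) <= n).
  { apply (Rmult_le_compat_l p) in H; [|lra].
    replace (p * ((p + n) / p)) with (p + n) in H by (field; lra). lra. }
  replace ((2 * (1 - p) * lam ^ 2 + (4 + n) * lam + (2 - 2 * p - n)) / (2 * (lam + 1)))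
    with (p * (lam + 1) / 2
          + (lam ^ 2 - 1) * (n - p * (lam - 1)) / (2 * (lam + 1) ^ 2)
          - (p - 1) * (lam + 1)) by (field; lra).
  apply Hq; [exact Hp1|]. eapply Rle_trans; [|exact Hk'].
  apply Rmult_le_compat_l; [apply Rmult_le_pos; lra|].
  apply Rinv_le_contravar; lra.
- assert (Hn : n <= p * (lam - 1)).
  { apply Rnot_le_lt in H. apply (Rmult_lt_compat_l p) in H; [|lra].
    replace (p * ((p + n) / p)) with (p + n) in H by (field; lra). lra. }
  replace ((2 * (1 - p) * lam ^ 2 + n * lam + (- 2 + 2 * p + n)) / (2 * (lam - 1)))
    with (p * (lam + 1) / 2
          + (lam ^ 2 - 1) * (n - p * (lam - 1)) / (2 * (lam - 1) ^ 2)
          - (p - 1) * (lam + 1)) by (field; lra).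
  apply Hq; [exact Hp1|]. eapply Rle_trans; [|exact Hk'].
  unfold Rdiv. apply Rmult_le_compat_neg_l; [nra|].
  apply Rinv_le_contravar; [nra|lra].
Qed.

(* Along the ray, [d|F|^2/dt = (2 Re h / t) |F|^2] (also where [F] vanishes,
   as both sides are then 0), so [|F|^2] cannot drop to 0. *)
Lemma radial_nonvanishing (F F1 h : C -> C) (z : C) (a : R) :
  0 < a < 1 -> F (a * z)%C <> 0%C ->
  (forall t, a <= t <= 1 -> cd F (t * z) (F1 (t * z)%C)) ->
  (forall t, a <= t <= 1 -> exists m, cd h (t * z) m) ->
  (forall t, a <= t <= 1 -> F (t * z)%C <> 0%C ->
     h (t * z)%C = (t * z * F1 (t * z) / F (t * z))%C) ->
  F z <> 0%C.
Proof.
intros Ha HFa HF Hh Hq.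
destruct (continuity_ab_maj (fun t => Cmod (h (0 + t * z)%C) ^ 2) a 1) as [tm [HB _]].
{ lra. }
{ intros t Ht. destruct (Hh t Ht) as [m Hm].
  apply derivable_continuous_pt. eexists. apply is_derive_Reals.
  apply (is_derive_Cmod2_line h 0 z m t). now rewrite Cplus_0_l. }
set (B := Cmod (h (0 + tm * z)%C) ^ 2) in *.
(* From [|h|^2 <= B] follows [Re h >= - (1 + B)], and [1 / t <= 1 / a]; hence [|F|^2] decays at rate
   at most [M]. *)
set (M := 2 * (1 + B) / a).
assert (HB0 : 0 <= B) by apply pow2_ge_0.
set (v (t : R) := 2 * Re (Cconj (F (0 + t * z)) * (F1 (t * z) * z))%C).
assert (Hv : forall t, a <= t <= 1 -> - M * Cmod (F (0 + t * z)%C) ^ 2 <= v t).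
{ intros t Ht. unfold v. specialize (HB t Ht). specialize (Hq t Ht).
  rewrite Cplus_0_l in *.
  destruct (classic (F (t * z)%C = 0%C)) as [E|E].
  - rewrite E, Cmod_0. simpl. lra.
  - specialize (Hq E).
    assert (Ht0 : RtoC t <> 0%C) by (intros E'; apply RtoC_inj in E'; lra).
    replace (Cconj (F (t * z)) * (F1 (t * z) * z))%C
      with (RtoC (Cmod (F (t * z)%C) ^ 2 / t) * h (t * z))%C.
    + set (X := Cmod (F (t * z)%C) ^ 2 / t).
      assert (HX : 0 <= X) by (apply Rdiv_le_0_compat; [apply pow2_ge_0 | lra]).
      assert (HXa : Cmod (F (t * z)%C) ^ 2 / a = X * (t / a)) by (unfold X; field; lra).
      assert (Hta : 1 <= t / a) by (apply Rle_div_r; lra).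
      replace (- M * Cmod (F (t * z)%C) ^ 2) with (- 2 * (1 + B) * (X * (t / a)))
        by (rewrite <- HXa; unfold M; field; lra).
      rewrite re_scal_l.
      assert (Hre : - (1 + B) <= Re (h (t * z)%C)).
      { rewrite Cmod2_alt in HB. generalize (pow2_ge_0 (Im (h (t * z)%C))). nra. }
      assert (0 <= X * (t / a - 1)) by (apply Rmult_le_pos; lra). nra.
    + rewrite Hq. unfold Rdiv. rewrite RtoC_mult, Cmod2_conj, RtoC_inv by lra.
      field. auto. }
intros Hz0.
(* With the integrating factor [exp (M t)] the function is nondecreasing, so it cannot go from a
   positive value at [a] to 0 at 1. *)
destruct (MVT_cor2 (fun t => Cmod (F (0 + t * z)%C) ^ 2 * exp (M * t))
  (fun t => v t * exp (M * t) + Cmod (F (0 + t * z)%C) ^ 2 * (M * exp (M * t))) a 1)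
  as [c [E Hc]]; [lra| |].
- intros t Ht. apply is_derive_Reals.
  assert (He : is_derive (fun t => exp (M * t)) t (M * exp (M * t)))
    by (auto_derive; auto; ring).
  assert (HFt : cd F (0 + t * z) (F1 (t * z)%C)) by (rewrite Cplus_0_l; now apply HF).
  evar_last.
  + exact (is_derive_mult _ _ t _ _ (is_derive_Cmod2_line F 0 z _ t HFt) He Rmult_comm).
  + unfold v. rewrite !Cplus_0_l. unfold plus, mult; simpl. ring.
- rewrite !Cplus_0_l, Cmult_1_l, Hz0, Cmod_0 in E.
  assert (He := exp_pos (M * c)). assert (Hea := exp_pos (M * a)).
  assert (Hpos : 0 < Cmod (F (a * z)%C) ^ 2) by (apply pow_lt; now apply Cmod_gt_0).
  specialize (Hv c ltac:(lra)). rewrite Cplus_0_l in Hv.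
  assert (0 < Cmod (F (a * z)%C) ^ 2 * exp (M * a)) by now apply Rmult_lt_0_compat.
  assert (0 <= (v c + M * Cmod (F (c * z)%C) ^ 2) * exp (M * c) * (1 - a)).
  { repeat apply Rmult_le_pos; lra. }
  nra.
Qed.

(** * The Schwarz function *)

Lemma RtoC_neq_0 (x : R) : x <> 0 -> RtoC x <> 0%C.
Proof. intros H E. apply H, RtoC_inj, E. Qed.

(** Pointwise form of the logarithmic derivative: [B2] stands for [z B'], so that
    [z D' = (lam - 1) p B - B2], and the last hypothesis is [z w' = k w]. The left side of the
    conclusion is [1 + z f''/f']. *)
Lemma boundary_relation (p lam k : R) (phi B B2 D w : C) :
  0 < p -> 1 < lam ->
  D = ((lam - 1) * p * phi - B)%C -> D <> 0%C -> (p * phi + B)%C <> 0%C ->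
  w = (- lam * B / D)%C -> Cmod w = 1 ->
  ((- lam * B2 * D - - lam * B * ((lam - 1) * p * B - B2)) / (D * D))%C = (k * w)%C ->
  w <> RtoC 1 /\
  (p + (p * B + B2) / (p * phi + B))%C
  = (p * (lam * (1 - w) / (lam - w)) + k * (w * (1 / (lam - w) - 1 / (1 - w))))%C.
Proof.
intros Hp Hlam HD HD0 HA Hw Hw1 Hk.
assert (Hp0 : RtoC p <> 0%C) by (apply RtoC_neq_0; lra).
assert (Hl0 : RtoC lam <> 0%C) by (apply RtoC_neq_0; lra).
assert (Hl1 : (lam - 1)%C <> 0%C) by (rewrite <- RtoC_minus; apply RtoC_neq_0; lra).
assert (E1 : (1 - w)%C = ((lam - 1) * (p * phi + B) / D)%C).
{ rewrite Hw. replace (RtoC 1) with (D / D)%C at 1 by (field; exact HD0).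
  rewrite HD at 1. field. exact HD0. }
assert (E2 : (lam - w)%C = (lam * (lam - 1) * p * phi / D)%C).
{ rewrite Hw. replace (RtoC lam) with (lam * D / D)%C at 1 by (field; exact HD0).
  rewrite HD at 1. field. exact HD0. }
(* A zero of [phi] would give [w = lam], of modulus greater than 1. *)
assert (Hphi : phi <> 0%C).
{ intros E. rewrite E in E2.
  assert (Ew : w = RtoC lam).
  { replace w with (lam - (lam - w))%C by ring. rewrite E2. field. exact HD0. }
  rewrite Ew, Cmod_R, Rabs_pos_eq in Hw1; lra. }
split.
{ intros E. rewrite E in E1. apply HA.
  replace (p * phi + B)%C with ((lam - 1) * (p * phi + B) / D * (D / (lam - 1)))%C
    by (field; auto).
  rewrite <- E1. field. exact Hl1. }
rewrite E1, E2, Hw.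
(* [z w' = k w] with denominators cleared. Solving it for [B2] leaves a rational identity in [phi],
   [B] and [k]. *)
assert (E3 : ((lam - 1) * p * (phi * B2 - B * B))%C = (k * B * D)%C).
{ replace ((lam - 1) * p * (phi * B2 - B * B))%C with
    ((- lam * B2 * D - - lam * B * ((lam - 1) * p * B - B2)) / (D * D)
     * (D * D / - lam))%C.
  - rewrite Hk, Hw. field. auto.
  - rewrite HD in *. field. repeat split; auto. }
assert (E4 : B2 = ((k * B * D / ((lam - 1) * p) + B * B) / phi)%C).
{ rewrite <- E3. field. auto. }
rewrite E4. clear - HD HD0 HA Hphi Hp0 Hl0 Hl1. subst D. field. repeat split; auto.
Qed.

Lemma clocally_smaller_modulus (z : C) (P : C -> Prop) :
  z <> 0%C -> clocally z P -> exists y, P y /\ Cmod y < Cmod z.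
Proof.
intros Hz H. apply clocally_Cmod_iff in H. destruct H as [d [Hd H]].
apply Cmod_gt_0 in Hz.
set (t := Rmin (1 / 2) (d / (2 * Cmod z))).
assert (Ht0 : 0 < t).
{ apply Rmin_pos; [lra|]. apply Rdiv_lt_0_compat; lra. }
assert (Ht1 : t <= 1 / 2) by apply Rmin_l.
assert (Ht2 : t * (2 * Cmod z) <= d).
{ apply Rle_div_r; [lra|]. apply Rmin_r. }
exists (RtoC (1 - t) * z)%C. split.
- apply H. rewrite RtoC_minus. replace ((1 - t) * z - z)%C with (- (t * z))%C by ring.
  rewrite Cmod_opp, Cmod_mult, Cmod_R, Rabs_pos_eq by lra. nra.
- rewrite Cmod_mult, Cmod_R, Rabs_pos_eq by lra. nra.
Qed.

(** [chi] records the zero of [phi1] of order [n' = n - 1] at the origin; the factor [z] in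
    [B = z phi1] raises the order to [n], as Jack's lemma requires. *)
Lemma schwarz_function_bound (p lam : R) (n' : nat)
  (phi phi1 phi2 chi chi1 : C -> C) :
  1 <= p -> 1 < lam ->
  (forall z, disk z -> cd phi z (phi1 z)) ->
  (forall z, disk z -> cd phi1 z (phi2 z)) ->
  (forall z, disk z -> exists m, cd phi2 z m) ->
  (forall z, disk z -> cd chi z (chi1 z)) ->
  (forall z, disk z -> exists m, cd chi1 z m) ->
  (forall z, disk z -> phi1 z = (z ^ n' * chi z)%C) ->
  phi 0%C = RtoC 1 ->
  (forall z, disk z -> (p * phi z + z * phi1 z)%C <> 0%C) ->
  (forall z, disk z -> z <> 0%C ->
     Re (p + (p * (z * phi1 z) + z * (phi1 z + z * phi2 z)) / (p * phi z + z * phi1 z))%C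
     < re_bound p (INR (S n')) lam) ->
  forall z, disk z ->
    Cmod (- lam * (z * phi1 z))%C ^ 2 < Cmod ((lam - 1) * p * phi z - z * phi1 z)%C ^ 2.
Proof.
intros Hp Hlam Hphi Hphi1 Hphi2 Hchi Hchi1 Hfac Hphi0 HA Hre zz Hzz.
apply Rnot_le_lt. intros Hcon.
set (N z := (- lam * (z * phi1 z))%C) in *.
set (D z := ((lam - 1) * p * phi z - z * phi1 z)%C) in *.
set (D1 z := ((lam - 1) * p * phi1 z - (phi1 z + z * phi2 z))%C).
assert (HN : forall z, disk z -> cd N z (- lam * (phi1 z + z * phi2 z))).
{ intros z Hz. eapply cd_eq.
  - apply cd_mult; [apply cd_const | apply cd_mult; [apply cd_id | now apply Hphi1]].
  - cbv beta. ring. }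
assert (HD : forall z, disk z -> cd D z (D1 z)).
{ intros z Hz. eapply cd_eq.
  - apply cd_minus; [apply cd_mult; [apply cd_const | now apply Hphi] |].
    apply cd_mult; [apply cd_id | now apply Hphi1].
  - unfold D1. ring. }
assert (HD1 : forall z, disk z -> exists m, cd D1 z m).
{ intros z Hz. destruct (Hphi2 z Hz) as [m Hm]. eexists.
  apply cd_minus; [apply cd_mult; [apply cd_const | now apply Hphi1] |].
  apply cd_plus; [now apply Hphi1 | apply cd_mult; [apply cd_id | exact Hm]]. }
assert (HD0 : Cmod (N 0%C) ^ 2 < Cmod (D 0%C) ^ 2).
{ unfold N, D. rewrite Hphi0, !Cmult_0_l, Cmult_0_r, Cmod_0.
  replace ((lam - 1) * p * 1 - 0)%C with (RtoC ((lam - 1) * p))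
    by (rewrite RtoC_mult, RtoC_minus; ring).
  rewrite Cmod_R, Rabs_pos_eq by nra. simpl. assert (0 < (lam - 1) * p) by nra. nra. }
assert (HcN : forall z, disk z -> ccontinuous (fun y => Cmod (N y) ^ 2) z)
  by (intros z Hz; eapply ccontinuous_Cmod2, HN, Hz).
assert (HcD : forall z, disk z -> ccontinuous (fun y => Cmod (D y) ^ 2) z)
  by (intros z Hz; eapply ccontinuous_Cmod2, HD, Hz).
destruct (compact_max
  (fun z => Cmod z <= Cmod zz /\ Cmod (D z) ^ 2 <= Cmod (N z) ^ 2)
  (fun z => - Cmod z) (Cmod zz)) as [z0 [[Hz0 HDN] Hmin]].
{ tauto. }
{ intros z Hz. destruct (Rle_dec (Cmod z) (Cmod zz)) as [Hle|Hgt].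
  - assert (Hd : disk z) by (unfold disk in *; lra).
    assert (Hc := continuous_minus (V := R_NormedModule) (U := C_UniformSpace)
      _ _ z (HcN z Hd) (HcD z Hd)).
    assert (Hlt : minus (Cmod (N z) ^ 2) (Cmod (D z) ^ 2) < 0).
    { unfold minus, plus, opp; simpl. lra. }
    apply filter_imp with (2 := ccontinuous_lt _ z 0 Hc Hlt).
    intros y Hy. unfold minus, plus, opp in Hy; simpl in Hy. lra.
  - apply filter_imp with (2 := clocally_Cmod_gt z _ (Rnot_le_lt _ _ Hgt)).
    intros y Hy. lra. }
{ intros z _. apply (continuous_opp (V := R_NormedModule) (U := C_UniformSpace)).
  apply (continuous_Cmod (fun y => y)), (cd_continuous _ _ _ (cd_id z)). }
{ exists zz. split; [lra | exact Hcon]. }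
set (r := Cmod z0).
unfold disk in Hzz.
assert (Hz0n : z0 <> 0%C) by (intros ->; lra).
assert (Hr : 0 < r) by now apply Cmod_gt_0.
assert (Hin : forall z, Cmod z < r -> Cmod (N z) ^ 2 < Cmod (D z) ^ 2).
{ intros z Hz. apply Rnot_le_lt. intros Hle. specialize (Hmin z).
  unfold r in *. lra. }
assert (Hdisk : forall z, Cmod z <= r -> disk z) by (unfold disk, r in *; intros; lra).
(* A strict failure on the circle would persist at a nearby point of smaller modulus. Equality at
   [z0] follows, and [|w| <= 1] on the whole circle. *)
assert (Hon : forall z, Cmod z = r -> Cmod (N z) ^ 2 <= Cmod (D z) ^ 2).
{ intros z Hz. apply Rnot_lt_le. intros Hlt.
  assert (Hd : disk z) by (apply Hdisk; lra).
  assert (Hc := continuous_minus (V := R_NormedModule) (U := C_UniformSpace)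
    _ _ z (HcD z Hd) (HcN z Hd)).
  assert (Hlt' : minus (Cmod (D z) ^ 2) (Cmod (N z) ^ 2) < 0).
  { unfold minus, plus, opp; simpl. lra. }
  destruct (clocally_smaller_modulus z _ ltac:(apply Cmod_gt_0; lra)
    (ccontinuous_lt _ z 0 Hc Hlt')) as [y [Hy1 Hy2]].
  specialize (Hin y ltac:(lra)).
  unfold minus, plus, opp in Hy1; simpl in Hy1. lra. }
(* Inside, the strict inequality excludes zeros of [D]. On the circle a zero of [D] is one of [B],
   hence of [phi], and [p phi + B] would vanish. *)
assert (HDn : forall z, Cmod z <= r -> D z <> 0%C).
{ intros z Hz E.
  destruct (Rle_lt_or_eq_dec _ _ Hz) as [Hlt|Heq].
  - specialize (Hin z Hlt). rewrite E, Cmod_0 in Hin.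
    generalize (pow2_ge_0 (Cmod (N z))). simpl in *. lra.
  - specialize (Hon z Heq). rewrite E, Cmod_0 in Hon.
    assert (EN : N z = 0%C).
    { apply Cmod_eq_0. generalize (Cmod_ge_0 (N z)). simpl in Hon. nra. }
    assert (Hl0 : RtoC lam <> 0%C) by (apply RtoC_neq_0; lra).
    assert (Hl1 : ((lam - 1) * p)%C <> 0%C)
      by (rewrite <- RtoC_minus, <- RtoC_mult; apply RtoC_neq_0; nra).
    apply (HA z (Hdisk z Hz)).
    assert (EB : (z * phi1 z)%C = 0%C).
    { replace (z * phi1 z)%C with (N z / - lam)%C
        by (unfold N; field; exact Hl0).
      rewrite EN. field. exact Hl0. }
    assert (EP : phi z = 0%C).
    { replace (phi z) with ((D z + z * phi1 z) / ((lam - 1) * p))%C.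
      - rewrite E, EB. field. split; intros E'; apply Hl1; rewrite E'; ring.
      - unfold D. field. split; intros E'; apply Hl1; rewrite E'; ring. }
    rewrite EP, EB. ring. }
set (w z := (N z / D z)%C).
set (g z := (- lam * chi z / D z)%C).
set (g1 z := ((- lam * chi1 z * D z - - lam * chi z * D1 z) / (D z * D z))%C).
assert (Hlchi : forall z, disk z -> cd (fun y => - lam * chi y)%C z (- lam * chi1 z)).
{ intros z Hz. eapply cd_eq; [apply cd_mult; [apply cd_const | now apply Hchi]|]. cbv beta. ring. }
assert (Hg : forall z, Cmod z <= r -> cd g z (g1 z)).
{ intros z Hz. apply (cd_div (fun y => - lam * chi y)%C D); auto. }
assert (HzD : disk z0) by (apply Hdisk; unfold r; lra).
assert (HD0' : D z0 <> 0%C) by (apply HDn; unfold r; lra).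
assert (Hw1 : Cmod (w z0) = 1).
{ unfold w. assert (HDp := proj1 (Cmod_gt_0 _) HD0').
  rewrite Cmod_div by exact HD0'.
  assert (E : Cmod (N z0) = Cmod (D z0)).
  { specialize (Hon z0 eq_refl). generalize (Cmod_ge_0 (N z0)). nra. }
  rewrite E. field. lra. }
destruct (jack (S n') w g g1 r z0
  ((- lam * (phi1 z0 + z0 * phi2 z0) * D z0 - N z0 * D1 z0) / (D z0 * D z0))%C)
  as [k [Hk Hzl]]; auto.
- intros z Hz. unfold w, g, N. rewrite (Hfac z (Hdisk z Hz)), Cpow_S.
  field. now apply HDn.
- intros z Hz. apply Hg. lra.
- intros z Hz. assert (Hzd : disk z) by (apply Hdisk; lra).
  assert (HDz : D z <> 0%C) by (apply HDn; lra).
  destruct (HD1 z Hzd) as [m1 Hm1]. destruct (Hchi1 z Hzd) as [m2 Hm2].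
  eexists. apply (cd_div (fun z => - lam * chi1 z * D z - - lam * chi z * D1 z)%C
    (fun z => D z * D z)%C).
  + now apply Cmult_neq_0.
  + apply cd_minus; apply cd_mult; eauto.
    apply cd_mult; [apply cd_const | exact Hm2].
  + apply cd_mult; auto.
- intros z Hz. exists (g1 z). apply Hg. lra.
- intros z Hz. assert (HDz : D z <> 0%C) by (apply HDn; lra).
  unfold w. rewrite Cmod_div by exact HDz. apply Cmod_gt_0 in HDz.
  apply Rle_div_l; [exact HDz|]. rewrite Rmult_1_l.
  specialize (Hon z Hz). generalize (Cmod_ge_0 (N z)). nra.
- apply cd_div; auto.
- destruct (boundary_relation p lam k (phi z0) (z0 * phi1 z0)
    (z0 * (phi1 z0 + z0 * phi2 z0)) (D z0) (w z0)) as [Hw1' HV]; auto; try lra.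
  + rewrite <- Hzl. unfold D1, N. field. exact HD0'.
  + specialize (Hre z0 HzD Hz0n).
    rewrite HV, Re_boundary_value in Hre by auto.
    assert (Hc : -1 <= Re (w z0) < 1).
    { assert (E : Re (w z0) ^ 2 + Im (w z0) ^ 2 = 1)
        by (rewrite <- Cmod2_alt, Hw1; ring).
      split; [nra|]. apply Rnot_le_lt. intros Hle. apply Hw1'.
      assert (E1 : Re (w z0) = 1) by nra. assert (E2 : Im (w z0) = 0) by nra.
      apply injective_projections; [exact E1 | exact E2]. }
    assert (Hb := re_bound_le p (INR (S n')) lam k (Re (w z0)) Hp Hlam Hk Hc).
    lra.
Qed.

(** * Power series factorisation of the functions in the class *)

Lemma is_pseries_cseries (a : nat -> C) (z l : C) :
  @is_pseries C_AbsRing C_NormedModule a z l -> cseries (fun k => a k * z ^ k)%C l.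
Proof.
apply cseries_ext. intros k. change (pow_n (K := C_Ring) z k * a k = a k * z ^ k)%C.
replace (pow_n (K := C_Ring) z k) with (z ^ k)%C; [ring|].
induction k as [|k IH]; [reflexivity|]. rewrite Cpow_S, IH. reflexivity.
Qed.

Lemma cd_ext_disk (f g : C -> C) (z l : C) :
  disk z -> (forall y, disk y -> f y = g y) -> cd f z l -> cd g z l.
Proof.
intros Hz E. unfold disk in *. apply cd_ext_loc with (1 - Cmod z); [lra|].
intros y Hy. apply E. generalize (Cmod_triangle z (y - z)).
replace (z + (y - z))%C with y by ring. lra.
Qed.

Lemma disk_0 : disk 0%C.
Proof. unfold disk. rewrite Cmod_0. lra. Qed.

(** Dropping the first [p] coefficients of [f] gives [phi]. Its derived series has coefficients
    [(k + 1) a (k + 1 + p)], which vanish for [k + 1 < n]; this is the factor [z ^ n']. All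
    derivatives are again power series, so they exist to every order used. *)
Lemma classA_factor (p n' : nat) (f : C -> C) :
  classA (S p) (S n') f ->
  exists phi phi1 phi2 phi3 chi chi1 chi2 : C -> C,
    (forall z, disk z -> f z = (z ^ S p * phi z)%C) /\
    phi 0%C = RtoC 1 /\
    (forall z, disk z -> cd phi z (phi1 z) /\ cd phi1 z (phi2 z) /\ cd phi2 z (phi3 z)) /\
    (forall z, disk z -> phi1 z = (z ^ n' * chi z)%C) /\
    (forall z, disk z -> cd chi z (chi1 z) /\ cd chi1 z (chi2 z)).
Proof.
intros [_ [a [Ha0 [Ha1 [Ha2 Ha]]]]].
assert (Hsum : forall z, disk z -> cseries (fun k => a k * z ^ k)%C (f z))
  by (intros z Hz; apply is_pseries_cseries, Ha, Hz).
assert (Hra := radius_ge_1_intro a f Hsum).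
set (b k := a (k + S p)%nat).
assert (Hb : radius_ge_1 b) by apply (radius_ge_1_shift (S p) a Hra).
assert (Hb1 := radius_ge_1_cderive _ Hb).
assert (Hb2 := radius_ge_1_cderive _ Hb1).
assert (Hc := radius_ge_1_shift n' _ Hb1).
assert (Hc1 := radius_ge_1_cderive _ Hc).
exists (psum b), (psum (cderive b)), (psum (cderive (cderive b))),
  (psum (cderive (cderive (cderive b)))),
  (psum (fun k => cderive b (k + n')%nat)),
  (psum (cderive (fun k => cderive b (k + n')%nat))),
  (psum (cderive (cderive (fun k => cderive b (k + n')%nat)))).
split; [|split; [|split; [|split]]].
- intros z Hz. rewrite <- (psum_unique a z (f z) (Hsum z Hz)).
  now apply psum_factor.
- rewrite psum_0 by exact Hb. unfold b. now rewrite Nat.add_0_l.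
- intros z Hz. repeat split; now apply psum_derive.
- intros z Hz. apply psum_factor; [exact Hb1 | exact Hz |].
  intros k Hk. unfold cderive, b. rewrite Ha2 by lia. ring.
- intros z Hz. split; now apply psum_derive.
Qed.

(** Multiplying the derivative by [z] covers exponent 0 too, which occurs for [f'] when [f] has a
    simple zero at the origin. *)
Lemma cd_mult_id_pow (p : nat) (z : C) :
  exists d, cd (fun y => y ^ p)%C z d /\ (z * d)%C = (INR p * z ^ p)%C.
Proof.
destruct p as [|p].
- exists 0%C. split; [apply (cd_const 1) | simpl; ring].
- exists (INR (S p) * z ^ p)%C. split; [apply cd_pow|]. rewrite Cpow_S. ring.
Qed.

Theorem theorem2p4 :
  forall (p n : nat) (lam : R) (f h : C -> C),
    (1 <= p)%nat -> (1 <= n)%nat ->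
    0 <= disc1 (INR p) (INR n) ->
    lambda1 (INR p) (INR n) < lam ->
    Rbar_lt (Finite lam) (lambda2 (INR p) (INR n)) ->
    classA p n f ->
    analytic_quotient
      (fun z : C => (z * C_derive (C_derive f) z)%C)
      (C_derive f) h ->
    (forall z : C, disk z -> Re (1 + h z)%C < re_bound (INR p) (INR n) lam) ->
    exists P : C -> C,
      analytic_quotient (fun z : C => (z * C_derive f z)%C) f P /\
      subordinate
        (fun z : C => (RtoC (/ INR p) * P z)%C)
        (fun z : C => (RtoC lam * (1 - z) / (RtoC lam - z))%C).
Proof.
intros p n lam f h Hp Hn Hdisc Hlam1 _ Hf [Hhan Hh] Hre.
destruct p as [|p']; [lia|]. destruct n as [|n']; [lia|].
destruct (classA_factor p' n' f Hf)
  as [phi [phi1 [phi2 [phi3 [chi [chi1 [chi2 [Hfphi [Hphi0 [Hphi [Hfac Hchi]]]]]]]]]]].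
assert (Hp1 : 1 <= INR (S p')) by (apply (le_INR 1); lia).
assert (Hn1 : 1 <= INR (S n')) by (apply (le_INR 1); lia).
assert (Hlam : 1 < lam).
{ generalize (lambda1_ge_1 _ _ Hp1 Hn1 Hdisc). lra. }
set (p := INR (S p')) in *.
set (A z := (p * phi z + z * phi1 z)%C).
set (A1 z := (p * phi1 z + (phi1 z + z * phi2 z))%C).
assert (HA1 : forall z, disk z -> cd A z (A1 z)).
{ intros z Hz. destruct (Hphi z Hz) as [H1 [H2 _]]. eapply cd_eq.
  - apply cd_plus; [apply cd_mult; [apply cd_const | exact H1] |].
    apply cd_mult; [apply cd_id | exact H2].
  - unfold A1. ring. }
assert (Hf1 : forall z, disk z -> C_derive f z = (z ^ p' * A z)%C).
{ intros z Hz. destruct (Hphi z Hz) as [H1 _]. apply is_C_derive_unique.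
  apply cd_ext_disk with (fun y => y ^ S p' * phi y)%C; [exact Hz | |].
  - intros y Hy. now rewrite Hfphi.
  - eapply cd_eq; [apply cd_mult; [apply cd_pow | exact H1]|].
    unfold A. rewrite Cpow_S. fold p. ring. }
assert (Hf2 : forall z, disk z -> exists F1,
  cd (C_derive f) z F1 /\ (z * F1)%C = (z ^ p' * (INR p' * A z + z * A1 z))%C).
{ intros z Hz. destruct (cd_mult_id_pow p' z) as [d [Hd Ed]].
  exists (d * A z + z ^ p' * A1 z)%C. split.
  - apply cd_ext_disk with (fun y => y ^ p' * A y)%C; [exact Hz | |].
    + intros y Hy. now rewrite Hf1.
    + apply cd_mult; auto.
  - rewrite Cmult_plus_distr_l, Cmult_assoc, Ed. ring. }
assert (Hf2' : forall z, disk z -> cd (C_derive f) z (C_derive (C_derive f) z)).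
{ intros z Hz. destruct (Hf2 z Hz) as [F1 [H1 _]].
  rewrite (is_C_derive_unique (C_derive f) z F1 H1). exact H1. }
assert (HA0 : A 0%C <> 0%C).
{ unfold A. rewrite Hphi0, Cmult_0_l, Cplus_0_r, Cmult_1_r. apply RtoC_neq_0. lra. }
assert (Hderiv_nz : forall z, disk z -> z <> 0%C -> C_derive f z <> 0%C).
{ intros z Hz Hz0. assert (Hzp := proj1 (Cmod_gt_0 z) Hz0). unfold disk in Hz.
  assert (HcA : ccontinuous (fun y => - Cmod (A y)) 0).
  { apply (continuous_opp (V := R_NormedModule) (U := C_UniformSpace)).
    apply continuous_Cmod, (cd_continuous A 0 _ (HA1 _ disk_0)). }
  apply Cmod_gt_0 in HA0.
  destruct (proj1 (clocally_Cmod_iff _ _) (ccontinuous_lt _ _ 0 HcA ltac:(lra)))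
    as [d [Hd HdA]].
  (* The ray starts at [a z] rather than at 0, where [f'] may vanish: [a z] is so close to 0 that
     [A], hence [f'], is nonzero there. *)
  set (a := Rmin (1 / 2) (d / 2)).
  assert (Ha : 0 < a /\ a <= 1 / 2 /\ a <= d / 2).
  { unfold a. split; [apply Rmin_pos; lra|]. split; [apply Rmin_l | apply Rmin_r]. }
  assert (Hdt : forall t, a <= t <= 1 -> disk (t * z)).
  { intros t Ht. unfold disk. rewrite Cmod_mult, Cmod_R, Rabs_pos_eq by lra. nra. }
  apply (radial_nonvanishing (C_derive f) (C_derive (C_derive f)) h z a).
  - lra.
  - rewrite Hf1 by (apply Hdt; lra). apply Cmult_neq_0.
    + apply Cpow_nz, Cmult_neq_0; [apply RtoC_neq_0; lra | exact Hz0].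
    + apply Cmod_gt_0.
      assert (Hlt : - Cmod (A (a * z)%C) < 0).
      { apply HdA. replace (a * z - 0)%C with (a * z)%C by ring.
        rewrite Cmod_mult, Cmod_R, Rabs_pos_eq by lra. nra. }
      lra.
  - intros t Ht. apply Hf2'. auto.
  - intros t Ht. apply Hhan. auto.
  - intros t Ht. apply Hh. auto. }
assert (HA : forall z, disk z -> A z <> 0%C).
{ intros z Hz. destruct (classic (z = 0%C)) as [->|Hz0]; [exact HA0|].
  intros E. apply (Hderiv_nz z Hz Hz0). rewrite Hf1, E by exact Hz. ring. }
assert (HB := schwarz_function_bound p lam n' phi phi1 phi2 chi chi1 Hp1 Hlam).
specialize (HB ltac:(apply Hphi) ltac:(apply Hphi)).
specialize (HB ltac:(intros z Hz; exists (phi3 z); apply (Hphi z Hz))).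
specialize (HB ltac:(apply Hchi)).
specialize (HB ltac:(intros z Hz; exists (chi2 z); apply (Hchi z Hz)) Hfac Hphi0 HA).
assert (HB' : forall z, disk z ->
  Cmod (- lam * (z * phi1 z))%C ^ 2 < Cmod ((lam - 1) * p * phi z - z * phi1 z)%C ^ 2).
(* Off the origin [f'] is nonzero, so [h] is the genuine quotient, and [f' = z ^ p' A] gives
   [1 + h = p + z A1 / A]. *)
{ apply HB. intros z Hz Hz0. eapply Rle_lt_trans; [|exact (Hre z Hz)].
  apply Req_le. f_equal. rewrite Hh by auto.
  destruct (Hf2 z Hz) as [F1 [H1 E1]].
  rewrite (is_C_derive_unique (C_derive f) z F1 H1), E1, Hf1 by exact Hz.
  replace (RtoC (INR p')) with (p - 1)%C
    by (unfold p; rewrite S_INR, RtoC_plus; ring).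
  assert (HAz := HA z Hz). unfold A, A1 in *.
  field. split; [exact HAz | now apply Cpow_nz]. }
clear HB.
set (D z := ((lam - 1) * p * phi z - z * phi1 z)%C).
assert (HD : forall z, disk z -> D z <> 0%C).
{ intros z Hz E. specialize (HB' z Hz). fold (D z) in HB'. rewrite E, Cmod_0 in HB'.
  generalize (pow2_ge_0 (Cmod (- lam * (z * phi1 z))%C)). simpl in *. lra. }
assert (Hl0 : RtoC lam <> 0%C) by (apply RtoC_neq_0; lra).
assert (Hl1 : (lam - 1)%C <> 0%C) by (rewrite <- RtoC_minus; apply RtoC_neq_0; lra).
assert (Hp0 : RtoC p <> 0%C) by (apply RtoC_neq_0; lra).
assert (Hphi_nz : forall z, disk z -> phi z <> 0%C).
(* A zero of [phi] makes [D = - B], so the estimate would read [lam |B| < |B|]. *)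
{ intros z Hz E. specialize (HB' z Hz). rewrite E in HB'.
  replace ((lam - 1) * p * 0 - z * phi1 z)%C with (- (z * phi1 z))%C in HB' by ring.
  rewrite Cmod_mult, !Cmod_opp, Cmod_R, Rabs_pos_eq in HB' by lra.
  assert (H0 := Cmod_ge_0 (z * phi1 z)%C).
  apply (Rlt_not_le _ _ HB'). apply pow_incr. nra. }
(* This is [z f'/f] with the common power [z ^ p] cancelled, so the value at 0 is [p]. *)
set (P z := (p + z * phi1 z / phi z)%C).
assert (HPan : analytic_on_disk P).
{ intros z Hz. destruct (Hphi z Hz) as [H1 [H2 _]]. eexists.
  apply cd_plus; [apply cd_const|]. apply cd_div; [auto | | exact H1].
  apply cd_mult; [apply cd_id | exact H2]. }
exists P. split; [split; [exact HPan|]|].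
- intros z Hz Hfz.
  assert (Hz0 : z <> 0%C).
  { intros ->. apply Hfz. rewrite Hfphi, Cpow_S by exact Hz. ring. }
  rewrite Hf1, Hfphi, Cpow_S by exact Hz. unfold P, A. field.
  split; [|split]; auto. now apply Cpow_nz.
- split; [|split].
  + intros z Hz. destruct (HPan z Hz) as [m Hm]. eexists.
    apply cd_mult; [apply cd_const | exact Hm].
  + intros z Hz. eexists. apply cd_div.
    * intros E. unfold disk in Hz. replace z with (lam - (lam - z))%C in Hz by ring.
      rewrite E in Hz. replace (lam - 0)%C with (RtoC lam) in Hz by ring.
      rewrite Cmod_R, Rabs_pos_eq in Hz; lra.
    * apply cd_mult; [apply cd_const|].
      apply cd_minus; [apply cd_const | apply cd_id].
    * apply cd_minus; [apply cd_const | apply cd_id].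
  + exists (fun z => - lam * (z * phi1 z) / D z)%C. split; [|split; [|split]].
    * intros z Hz. destruct (Hphi z Hz) as [H1 [H2 _]]. eexists.
      apply cd_div; [auto | |].
      -- apply cd_mult; [apply cd_const | apply cd_mult; [apply cd_id | exact H2]].
      -- apply cd_minus; [apply cd_mult; [apply cd_const | exact H1] |].
         apply cd_mult; [apply cd_id | exact H2].
    * intros z Hz. unfold disk. specialize (HD z Hz). specialize (HB' z Hz).
      fold (D z) in HB'.
      rewrite Cmod_div by exact HD. apply Cmod_gt_0 in HD.
      apply Rlt_div_l; [exact HD|]. rewrite Rmult_1_l.
      generalize (Cmod_ge_0 (- lam * (z * phi1 z))%C). nra.
    * specialize (HD _ disk_0). rewrite !Cmult_0_l. field. exact HD.
    * intros z Hz. specialize (HD z Hz). specialize (Hphi_nz z Hz).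
      rewrite RtoC_inv by lra. unfold P. unfold D in *. field. repeat split; auto.
      (* The last denominator is [D (lam - w)], which simplifies to a nonzero multiple of [phi]. *)
      replace (lam * ((lam - 1) * p * phi z - z * phi1 z) - - lam * (z * phi1 z))%C
        with (lam * (lam - 1) * p * phi z)%C by ring.
      repeat apply Cmult_neq_0; auto.
Qed.
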